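(* Let $\langle X,R\rangle$ be any analytic digraph. Exactly one of the following alternatives holds: (1) $\vec{\chi}^{w}_{B}(\langle X,R\rangle)\leq\aleph_0$; (2) for every selector $E$, there exists $f\in\mathcal{F}$ such that both of the following hold: (a) for all $n,m\in\omega$, if $E(f\restriction m)\subseteq E(f\restriction n)$, then $f(m)\leq f(n)$; (b) there is a continuous homomorphism $\Pi$ from $\mathcal{G}_0(E,f)$ to $\langle X,R\rangle$; and furthermore, if $\langle X,R\rangle$ is $k$-uniform, then (this $f$ may be taken so that) $f(n)\leq k+1$ for every $n\in\omega$.
   Context: Digraphs: a digraph is a pair $\langle X,R\rangle$ with $R\subseteq X\times X$ and $\langle x,x\rangle\notin R$ for all $x\in X$. It is Borel (analytic) if $X$ is a Polish space and $R$ is a Borel (analytic) subset of $X\times X$. For $Y\subseteq X$, an $R$-cycle in $Y$ is a finite non-empty sequence $\langle y_0,\dots,y_k\rangle$ of elements of $Y$ with $y_i R y_{i+1}$ for all $i<k$ and $y_k R y_0$; its length is $k$ (one less than the number of terms). The cycle $\langle x_0,\dots,x_n\rangle$ is minimal if for all $i,j<n+1$: $\langle x_i,x_j\rangle\in R$ iff $j=i+1 \bmod (n+1)$. A digraph $\langle X,R\rangle$ is $k$-uniform if every minimal cycle in $X$ has length at most $k$. For an analytic digraph $\langle X,R\rangle$, the weak Borel dichromatic number $\vec{\chi}^{w}_{B}(\langle X,R\rangle)$ is the minimal cardinal $\kappa$ such that $X=\bigcup_{\alpha<\kappa}X_\alpha$ for some Borel sets $X_\alpha\subseteq X$ none of which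 contains an $R$-cycle. A homomorphism from a digraph $\langle X,R\rangle$ to a digraph $\langle Y,S\rangle$ is a function $\Pi:X\to Y$ such that $\langle x,y\rangle\in R$ implies $\langle\Pi(x),\Pi(y)\rangle\in S$. Let $\mathcal{F}=\{f\in\omega^\omega:\forall k\, f(k)\geq 2\}$ and $\mathcal{F}_{<\omega}=\bigcup_{l<\omega}\{s\in\omega^l:\forall k<l\ s(k)\geq2\}$. For $\sigma\in\mathcal{F}_{<\omega}$ let $T_{[\sigma]}=\prod_{k\in\mathrm{dom}(\sigma)}\sigma(k)$. For $f\in\mathcal{F}$ let $T_f=\bigcup_{l\in\omega}\prod_{k<l}f(k)$ and $[T_f]=\prod_{k\in\omega}f(k)$, with the product topology. A selector is a function $E:\mathcal{F}_{<\omega}\to\omega^{<\omega}$ with $E(\sigma)\in T_{[\sigma]}$ for every $\sigma$. For a selector $E$ and $f\in\mathcal{F}$, $\mathcal{G}_0(E,f)=\langle[T_f],R_{E,f}\rangle$ is the Borel digraph where for $y,z\in[T_f]$, $\langle y,z\rangle\in R_{E,f}$ iff there exist $l\in\omega$ and $x\in\omega^\omega$ such that $z(l)=y(l)+1 \bmod f(l)$, $y=E(f\restriction l)^\frown\langle y(l)\rangle^\frown x$ and $z=E(f\restriction l)^\frown\langle z(l)\rangle^\frown x$. *)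

(* Defs.v *)
From mathcomp Require Import all_boot all_order all_algebra.
From mathcomp Require Import all_classical all_reals topology measure.

Set Implicit Arguments.
Unset Strict Implicit.
Unset Printing Implicit Defensive.

Import Order.TTheory GRing.Theory Num.Theory.

Local Open Scope classical_set_scope.
Local Open Scope card_scope.

Definition is_metric (K : realType) (T : Type) (d : T -> T -> K) : Prop :=
  [/\ forall x, d x x = 0%R,
      forall x y, d x y = 0%R -> x = y,
      forall x y, d x y = d y x &
      forall x y z, (d x z <= d x y + d y z)%R].

Definition metric_compatible (K : realType) (T : topologicalType)
    (d : T -> T -> K) : Prop :=
  forall (x : T) (A : set T),
    nbhs x A <-> exists2 e : K, (0 < e)%R & [set y | (d x y < e)%R] `<=` A.

(* The library's [completeType] is pointed, so it excludes the empty space;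
   completeness is therefore stated with Cauchy sequences. *)
Definition metric_complete (K : realType) (T : topologicalType)
    (d : T -> T -> K) : Prop :=
  forall u : nat -> T,
    (forall e : K, (0 < e)%R ->
       exists N, forall m n, N <= m -> N <= n -> (d (u m) (u n) < e)%R) ->
    exists l : T, u @ \oo --> l.

Definition separable (T : topologicalType) : Prop :=
  exists2 D : set T, countable D & dense D.

Definition polish (K : realType) (T : topologicalType) : Prop :=
  separable T /\
  exists d : T -> T -> K,
    [/\ is_metric d, metric_compatible d & metric_complete d].

Definition borel (T : topologicalType) : set (set T) := <<s @open T >>.

(* The empty set is included, as the image of the empty Polish space. *)
Definition analytic (K : realType) (T : topologicalType) (A : set T) : Prop :=
  exists (Y : topologicalType) (g : Y -> T),
    [/\ polish K Y, continuous g & range g = A].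

Section Digraphs.
Context {X : topologicalType}.
Implicit Type R : set (X * X).

Definition is_digraph R : Prop := forall x, ~ R (x, x).

Definition analytic_digraph (K : realType) R : Prop :=
  [/\ polish K X, is_digraph R & analytic K R].

(* [ordS i] is the successor of [i] modulo [n.+1]. *)
Definition is_cycle R (Y : set X) (n : nat) (y : 'I_n.+1 -> X) : Prop :=
  (forall i, Y (y i)) /\ (forall i, R (y i, y (ordS i))).

Definition minimal_cycle R (n : nat) (x : 'I_n.+1 -> X) : Prop :=
  is_cycle R setT x /\ (forall i j, R (x i, x j) <-> j = ordS i).

(* The length of a cycle is one less than its number of terms. *)
Definition uniform_digraph (k : nat) R : Prop :=
  forall n (x : 'I_n.+1 -> X), minimal_cycle R x -> n <= k.

(* Cardinals are represented by sets, compared with [#<=]. *)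
Definition weak_borel_colorable R (I : Type) (kappa : set I) : Prop :=
  exists A : I -> set X,
    [/\ forall i, kappa i -> borel (A i),
        forall i, kappa i ->
          ~ exists (n : nat) (y : 'I_n.+1 -> X), is_cycle R (A i) y &
        \bigcup_(i in kappa) A i = setT].

Definition weak_borel_dichromatic_number R (I : Type) (kappa : set I) : Prop :=
  weak_borel_colorable R kappa /\
  forall (J : Type) (lambda : set J),
    weak_borel_colorable R lambda -> kappa #<= lambda.

Definition countable_weak_borel_dichromatic_number R : Prop :=
  exists (I : Type) (kappa : set I),
    weak_borel_dichromatic_number R kappa /\ kappa #<= [set: nat].

End Digraphs.

Definition homomorphism (X Y : Type) (R : set (X * X)) (S : set (Y * Y))
    (h : X -> Y) : Prop :=
  forall x y, R (x, y) -> S (h x, h y).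

Definition baire_space : topologicalType := {ptws nat -> nat}.

Definition calF : set (nat -> nat) := [set f | forall k, 2 <= f k].

Definition calF_fin : set (seq nat) :=
  [set s | forall k, k < size s -> 2 <= nth 0 s k].

Definition T_fin (s : seq nat) : set (seq nat) :=
  [set t | size t = size s /\ forall k, k < size s -> nth 0 t k < nth 0 s k].

(* The values of a selector outside [calF_fin] are irrelevant. *)
Definition selector (E : seq nat -> seq nat) : Prop :=
  forall s, calF_fin s -> T_fin s (E s).

Definition restr (f : nat -> nat) (l : nat) : seq nat := mkseq f l.

(* Coerced to a type, this carries the subspace topology of the Baire space,
   which is the product topology of the discrete spaces [f k]. *)
Definition branches (f : nat -> nat) : set baire_space :=
  [set y : baire_space | forall k, y k < f k].

Definition concat (s : seq nat) (x : nat -> nat) : nat -> nat :=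
  fun k => if k < size s then nth 0 s k else x (k - size s).

Definition G0 (E : seq nat -> seq nat) (f : nat -> nat) :
    set (branches f * branches f) :=
  [set yz | exists (l : nat) (x : nat -> nat),
     let y : nat -> nat := set_val yz.1 in
     let z : nat -> nat := set_val yz.2 in
     [/\ z l = (y l + 1) %% f l,
         y = concat (rcons (E (restr f l)) (y l)) x &
         z = concat (rcons (E (restr f l)) (z l)) x]].

Definition selector_monotone (E : seq nat -> seq nat) (f : nat -> nat) : Prop :=
  forall n m, prefix (E (restr f m)) (E (restr f n)) -> f m <= f n.

Definition continuous_hom_from_G0 (X : topologicalType) (R : set (X * X))
    (E : seq nat -> seq nat) (f : nat -> nat) : Prop :=
  exists h : branches f -> X, continuous h /\ homomorphism (@G0 E f) R h.

(* Main.v *)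
Require Import Defs.
From mathcomp Require Import all_boot all_order all_algebra.
From mathcomp Require Import all_classical all_reals topology measure.

Set Implicit Arguments.
Unset Strict Implicit.
Unset Printing Implicit Defensive.

Import Order.TTheory GRing.Theory Num.Theory.

Local Open Scope classical_set_scope.
Local Open Scope card_scope.

(** Call a subset of X sigma-acyclic when it is covered by countably many Borel
sets without R-cycles; the first alternative says that X is sigma-acyclic
([countable_dichromaticP]).

The alternatives exclude each other by Baire category. There is a selector E
whose values extend every word of T_f, for every f ([exists_dense_selector]).
Given a continuous homomorphism from G_0(E, f) to a sigma-acyclic digraph, one of
the pulled back Borel sets is comeager in some cone of T_f, hence in the cone
below e := E (f|l) for some l. A generic tail x then puts all f(l) branches
e i x into this set; they form a cycle of G_0(E, f), whose image is an R-cycle in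
a set without cycles ([no_hom_from_dense_G0]).

Conversely, let X be not sigma-acyclic. The homomorphism is built by finite
approximations. For s = f|n, a configuration assigns a point of X to every word
in the product of s so that the edges of the finite version of G_0 on these words
are respected. A set of configurations is large when no sigma-acyclic set meets
all of them. The key step ([large_extend]) is that from a large set D some
m >= 2 gives a large set of configurations over s m, each made of m members of D
joined along an R-cycle at the word E(s). Otherwise remove from X the countably
many sigma-acyclic sets that witness the failure for each m: the values at E(s)
of the surviving members of D contain no cycle at all. They form an analytic
set, so they are covered by one Borel set without cycles
([borel_acyclic_hull]), and D was not large. Only the lengths of minimal cycles
matter in this argument, whence m <= k + 1 for a k-uniform digraph.

Always taking the least such m makes f monotone as required: restricting a configuration over f|n
to the words ending in a fixed tail gives one over f|m, and when E(f|n) extends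
E(f|m) with that tail, a cycle at E(f|n) becomes a cycle at E(f|m)
([extendible_prefix]). Since every point of X and every element of R is decoded
from an element of the Baire space, further digits of each of the finitely many
codes in play can be fixed at each stage without losing largeness
([countable_choice_large]). In the limit the digits fixed along a branch of T_f
decode to its image, and those fixed along an edge of G_0(E, f) decode to an
element of R ([limit_hom]). *)

(** * Analytic sets through codes *)

Definition agree (n : nat) (a b : nat -> nat) : Prop :=
  forall i, i < n -> a i = b i.

(** The set of codes is closed in the Baire space and decoding is continuous on
it. Decoding is a relation because a function would need a default value, which
an empty space does not have; it is single valued when Z is Hausdorff. *)
Definition complete_code (Z : topologicalType) (C : (nat -> nat) -> set Z) :=
  forall a, (forall n, exists b z, agree n a b /\ C b z) ->
  exists2 z, C a z & forall O, nbhs z O ->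
    exists n, forall b z', agree n a b -> C b z' -> O z'.

(** In a Hausdorff space, the continuous images of closed subsets of the Baire
space, that is, the analytic sets. *)
Definition souslin (Z : topologicalType) (A : set Z) : Prop :=
  exists2 C : (nat -> nat) -> set Z,
    complete_code C & forall z, A z <-> exists a, C a z.

Lemma agreeS m n a b : m <= n -> agree n a b -> agree m a b.
Proof. by move=> mn ab i im; apply: ab; apply: leq_trans im mn. Qed.

Lemma hausdorff_sep (T : topologicalType) (x y : T) : hausdorff_space T ->
  (forall A B, nbhs x A -> nbhs y B -> exists z, A z /\ B z) -> x = y.
Proof. by move=> hT h; apply: hT => A B xA yB; apply: h. Qed.

Lemma continuous_pair (Z S T : topologicalType) (f : Z -> S) (g : Z -> T) :
  continuous f -> continuous g -> continuous (fun z => (f z, g z)).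
Proof. by move=> cf cg z; apply: cvg_pair; [exact: cf|exact: cg]. Qed.

Lemma continuous_fst (S T : topologicalType) : continuous (@fst S T).
Proof. by move=> z; exact: cvg_fst. Qed.

Lemma continuous_snd (S T : topologicalType) : continuous (@snd S T).
Proof. by move=> z; exact: cvg_snd. Qed.

Lemma hausdorff_prod (S T : topologicalType) :
  hausdorff_space S -> hausdorff_space T -> hausdorff_space (S * T)%type.
Proof.
move=> hS hT p q pq; rewrite (surjective_pairing p) (surjective_pairing q).
congr pair.
  apply: (hausdorff_sep hS) => A B pA qB.
  have cA : nbhs p (fst @^-1` A) by exact: (@continuous_fst S T p _ pA).
  have cB : nbhs q (fst @^-1` B) by exact: (@continuous_fst S T q _ qB).
  by have [z [Az Bz]] := pq _ _ cA cB; exists z.1.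
apply: (hausdorff_sep hT) => A B pA qB.
have cA : nbhs p (snd @^-1` A) by exact: (@continuous_snd S T p _ pA).
have cB : nbhs q (snd @^-1` B) by exact: (@continuous_snd S T q _ qB).
by have [z [Az Bz]] := pq _ _ cA cB; exists z.2.
Qed.

Lemma compatible_metric_hausdorff (K : realType) (T : topologicalType)
    (d : T -> T -> K) :
  is_metric d -> metric_compatible d -> hausdorff_space T.
Proof.
move=> [d0 d0eq dC dT] dN x y xy; apply: d0eq; apply/eqP.
have dge0 u v : (0 <= d u v)%R.
  have := dT u v u; rewrite d0 (dC v u) -mulr2n.
  by rewrite pmulrn_lge0.
case: eqP => // /eqP dn0; have dp : (0 < d x y / 2)%R.
  by rewrite divr_gt0 // lt_def dn0 dge0.
have bN u : nbhs u [set v | (d u v < d x y / 2)%R].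
  by apply/dN; exists (d x y / 2)%R.
have [z [xz yz]] := xy _ _ (bN x) (bN y).
have := le_lt_trans (dT x z y) (ltrD xz _); rewrite (dC z y).
by move=> /(_ _ yz); rewrite -splitr ltxx.
Qed.

(** A code of y lists, for each n, the index of a point of a countable dense set
at distance at most 1/(n+1) from y. The inequality is not strict, so that the
limit of points sharing longer and longer parts of a code has that code. *)
Lemma souslin_polish (K : realType) (T : topologicalType) :
  polish K T -> souslin [set: T].
Proof.
case=> -[D Dct Dd] [d [[d0 d0eq dC dT] dN dcmp]].
have [i iD] : exists f : T -> nat, {in D &, injective f} by apply/countable_injP.
pose r n : K := (n.+1%:R^-1)%R.
have r_gt0 n : (0 < r n)%R by rewrite invr_gt0 ltr0n.
have rlim e : (0 < e)%R -> exists n, (r n + r n < e)%R.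
  move=> e0; have e20 : (0 < e / 2)%R by rewrite divr_gt0.
  exists (Num.truncn (e / 2)^-1).
  suff h : (r (Num.truncn (e / 2)^-1) < e / 2)%R.
    by rewrite [ltRHS]splitr ltrD.
  by rewrite /r invf_plt ?posrE ?ltr0n // truncnS_gt.
exists (fun a y => forall n, exists2 x, D x & i x = a n /\ (d y x <= r n)%R).
- move=> a ha.
  have [y hy] : {y : nat -> T & forall n, exists b, agree n a b /\
      forall m, exists2 x, D x & i x = b m /\ (d (y n) x <= r m)%R}.
    apply: (@choice _ _ (fun n z => exists b, agree n a b /\
      forall m, exists2 x, D x & i x = b m /\ (d z x <= r m)%R)) => n.
    by have [b [z [? ?]]] := ha n; exists z, b.
  have close N b z : agree N.+1 a b ->
      (forall m, exists2 x, D x & i x = b m /\ (d z x <= r m)%R) ->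
      exists2 x, D x & i x = a N /\ (d z x <= r N)%R.
    by move=> ab /(_ N)[x Dx [ix dx]]; exists x => //; rewrite ab.
  have close2 N b b' z z' : agree N.+1 a b -> agree N.+1 a b' ->
      (forall m, exists2 x, D x & i x = b m /\ (d z x <= r m)%R) ->
      (forall m, exists2 x, D x & i x = b' m /\ (d z' x <= r m)%R) ->
      (d z z' <= r N + r N)%R.
    move=> ab ab' zb zb'; have [x Dx [ix dx]] := close _ _ _ ab zb.
    have [x' Dx' [ix' dx']] := close _ _ _ ab' zb'.
    have xx' : x' = x by apply: iD; rewrite ?inE // ix.
    by apply: le_trans (dT _ x _) _; rewrite lerD // dC -xx'.
  have [l yl] : exists l : T, y @ \oo --> l.
    apply: dcmp => e /rlim[N rN]; exists N.+1 => m n Nm Nn.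
    have [b [ab zb]] := hy m; have [b' [ab' zb']] := hy n.
    apply: le_lt_trans rN.
    by apply: close2 zb zb'; [exact: agreeS ab|exact: agreeS ab'].
  have yl' e N : (0 < e)%R -> exists2 n, N <= n & (d l (y n) < e)%R.
    move=> e0; have /yl[M _ hM] : nbhs l [set z | (d l z < e)%R].
      by apply/dN; exists e.
    by exists (maxn N M); [exact: leq_maxl|apply: hM; exact: leq_maxr].
  have Cl n : exists2 x, D x & i x = a n /\ (d l x <= r n)%R.
    have [b [z [ab zb]]] := ha n.+1.
    have [x Dx [ix dx]] := close _ _ _ ab zb.
    exists x => //; split=> //; apply/ler_addgt0Pr => e e0.
    have [m nm lm] := yl' e n.+1 e0.
    have [b' [ab' zb']] := hy m.
    have [x' Dx' [ix' dx']] := close _ _ _ (agreeS nm ab') zb'.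
    have xx' : x' = x by apply: iD; rewrite ?inE // ix.
    apply: le_trans (dT _ (y m) _) _; rewrite addrC -xx' lerD //; exact: ltW.
  exists l => // O /dN[e e0 eO]; have [N rN] := rlim e e0.
  exists N.+1 => b z ab zb; apply: eO; apply: le_lt_trans rN.
  exact: (@close2 N a b).
- move=> y; split=> // _.
  have h n : exists k, exists2 x, D x & i x = k /\ (d y x <= r n)%R.
    have : nbhs y [set z | (d y z < r n)%R] by apply/dN; exists (r n).
    rewrite nbhsE => -[O [oO Oy] sO].
    have [z [Oz Dz]] := Dd O (ex_intro _ y Oy) oO.
    by exists (i z), z => //; split=> //; apply: ltW; apply: sO.
  by have [a ha] := choice h; exists a.
Qed.

Lemma souslin_closed (Z : topologicalType) (A F : set Z) :
  souslin A -> closed F -> souslin (A `&` F).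
Proof.
move=> [C cC CA] cF; exists (fun a z => C a z /\ F z); last first.
  move=> z; split=> [[/CA[a Ca] Fz]|[a [Ca Fz]]]; first by exists a.
  by split=> //; apply/CA; exists a.
move=> a ha; have [|z Cz zO] := cC a.
  by move=> n; have [b [z [ab [Cz _]]]] := ha n; exists b, z.
exists z; last first.
  by move=> O /zO[n hn]; exists n => b z' ab [Cz' _]; apply: hn ab Cz'.
split=> //; apply: cF => O /zO[n hn].
by have [b [z' [ab [Cz' Fz']]]] := ha n; exists z'; split=> //; apply: hn ab _.
Qed.

Lemma souslin_image (Z Z' : topologicalType) (f : Z -> Z') (A : set Z) :
  continuous f -> souslin A -> souslin (f @` A).
Proof.
move=> cf [C cC CA]; exists (fun a z' => exists2 z, C a z & f z = z').
- move=> a ha; have [|z Cz zO] := cC a.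
    by move=> n; have [b [_ [ab [z Cz _]]]] := ha n; exists b, z.
  exists (f z); first by exists z.
  move=> O /cf /zO[n hn]; exists n => b _ ab [z' Cz' <-].
  exact: hn ab Cz'.
- move=> z'; split=> [[z /CA[a Ca] <-]|[a [z Ca <-]]]; first by exists a, z.
  by exists z => //; apply/CA; exists a.
Qed.

Lemma souslin_bigcup (Z : topologicalType) (A : nat -> set Z) :
  (forall n, souslin (A n)) -> souslin (\bigcup_n A n).
Proof.
move=> sA; have /choice[C hC] : forall n, exists C : (nat -> nat) -> set Z,
    complete_code C /\ forall z, A n z <-> exists a, C a z.
  by move=> n; have [C] := sA n; exists C.
have CC n : complete_code (C n) by case: (hC n).
have CA n z : A n z <-> exists a, C n a z by case: (hC n) => _; apply.
exists (fun a z => C (a 0) (fun i => a i.+1) z); last first.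
  move=> z; split=> [[n _ /CA[a Ca]]|[a Ca]]; last first.
    by exists (a 0) => //; apply/CA; exists (fun i => a i.+1).
  by exists (fun i => if i is j.+1 then a j else n).
move=> a ha; have [|z Cz zO] := CC (a 0) (fun i => a i.+1).
  move=> n; have [b [z [ab Cz]]] := ha n.+1; exists (fun i => b i.+1), z.
  by rewrite (ab 0) //; split=> // i ? ; exact: ab.
exists z => // O /zO[n hn]; exists n.+1 => b z' ab Cz'.
apply: (hn (fun i => b i.+1)); first by move=> i ?; apply: ab.
by rewrite (ab 0).
Qed.

(** Splits a sequence into countably many sequences; [row_surj] puts them back
together. *)
Definition row (I : countType) (a : nat -> nat) (i : I) : nat -> nat :=
  fun n => a (pickle (i, n)).

Lemma agree_row (I : countType) (i : I) n :
  exists N, forall a b, agree N a b -> agree n (row a i) (row b i).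
Proof.
elim: n => [|n [N hN]]; first by exists 0.
exists (maxn N (pickle (i, n)).+1) => a b ab j.
rewrite ltnS leq_eqVlt => /orP[/eqP->|jn].
  by apply: ab; exact: leq_maxr.
by apply: hN jn; apply: agreeS ab; exact: leq_maxl.
Qed.

Lemma row_surj (I : countType) (b : I -> nat -> nat) :
  exists a, forall i, row a i = b i.
Proof.
exists (fun k => if unpickle k is Some p then b p.1 p.2 else 0) => i.
by apply/funext => n; rewrite /row pickleK.
Qed.

(** A code of z interleaves a code of z itself, in the row of [None], with codes
of all its images [f i z]. Since [Z_ i] is Hausdorff, the limit decoded from the
row of [i] can only be the image of the limit decoded from the row of [None]. *)
Lemma souslin_bigcap (I : countType) (Q : I -> Prop) (Z : topologicalType)
    (Z_ : I -> topologicalType) (D : set Z) (f : forall i, Z -> Z_ i)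
    (A : forall i, set (Z_ i)) :
  souslin D -> (forall i, hausdorff_space (Z_ i)) ->
  (forall i, continuous (f i)) ->
  (forall i, Q i -> souslin (A i)) ->
  souslin [set z | D z /\ forall i, Q i -> A i (f i z)].
Proof.
move=> [C0 cC0 C0D] hZ cf sA.
have /all_sig[C hC] : forall i, {C : (nat -> nat) -> set (Z_ i) |
   Q i -> complete_code C /\ forall z, A i z <-> exists a, C a z}.
  move=> i; apply: cid; have [/sA[C cC CA]|nQ] := pselect (Q i); first by exists C.
  by exists (fun _ _ => False).
exists (fun a z => C0 (row a (None : option I)) z /\
    forall i, Q i -> C i (row a (Some i)) (f i z)); last first.
  move=> z; split=> [[/C0D[a0 h0] h]|[a [Ca0 Ca]]]; last first.
    split; first by apply/C0D; exists (row a (None : option I)).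
    by move=> i Qi; apply/(hC i Qi).2; exists (row a (Some i)); apply: Ca.
  have /choice[b hb] : forall i, exists b, Q i -> C i b (f i z).
    move=> i; have [Qi|nQ] := pselect (Q i); last by exists (fun=> 0).
    by have /(hC i Qi).2[b Cb] := h i Qi; exists b.
  have [a ha] := row_surj (fun o : option I => if o is Some i then b i else a0).
  exists a; rewrite ha; split=> // i Qi; rewrite ha; exact: hb.
move=> a ha; have [|z Cz zO] := cC0 (row a (None : option I)).
  move=> n; have [N hN] := agree_row (None : option I) n.
  have [b [z [ab [Cz _]]]] := ha N; exists (row b (None : option I)), z; split=> //.
  exact: hN.
exists z; last first.
  move=> O /zO[n hn]; have [N hN] := agree_row (None : option I) n.
  by exists N => b z' /hN ab [Cz' _]; apply: hn ab Cz'.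
split=> // i Qi; have [cC CA] := hC i Qi.
have [|u Cu uO] := cC (row a (Some i)).
  move=> n; have [N hN] := agree_row (Some i) n.
  have [b [z' [ab [_ /(_ i Qi) Cz']]]] := ha N.
  by exists (row b (Some i)), (f i z'); split=> //; exact: hN.
suff -> : f i z = u by [].
apply: (hausdorff_sep (hZ i)) => U V /cf/zO[n hn] /uO[m hm].
have [N hN] := agree_row (None : option I) n.
have [M hM] := agree_row (Some i) m.
have [b [z' [ab [Cz' /(_ i Qi) Cfz']]]] := ha (maxn N M).
exists (f i z'); split.
  by apply: hn Cz'; apply: hN; apply: agreeS ab; exact: leq_maxl.
by apply: hm Cfz'; apply: hM; apply: agreeS ab; exact: leq_maxr.
Qed.

Lemma souslin_prod (J : countType) (T : topologicalType) :
  souslin [set: T] -> souslin [set: {ptws J -> T}].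
Proof.
move=> [C cC CT].
exists (fun a (g : {ptws J -> T}) => forall j, C (row a j) (g j)); last first.
  move=> g; split=> // _; have /choice[b hb] : forall j, exists b, C b (g j).
    by move=> j; apply/CT.
  by have [a ha] := row_surj b; exists a => j; rewrite ha.
move=> a ha.
have /choice[g hg] : forall j : J, exists z : T, C (row a j) z /\
    forall O : set T, nbhs z O ->
    exists n, forall b z', agree n (row a j) b -> C b z' -> O z'.
  move=> j; have [|z Cz zO] := cC (row a j); last by exists z.
  move=> n; have [N hN] := agree_row j n.
  by have [b [h [/hN ab Cb]]] := ha N; exists (row b j), (h j).
exists (g : {ptws J -> T}); first by move=> j; have [] := hg j.
pose base n := [set h : {ptws J -> T} |
  exists2 b, agree n a b & forall j, C (row b j) (h j)].
pose F := filter_from [set: nat] base.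
have FF : Filter F.
  apply: filter_from_filter; first by exists 0.
  move=> m n _ _; exists (maxn m n) => // h [b ab hb]; split; exists b => //.
    by apply: agreeS ab; exact: leq_maxl.
  by apply: agreeS ab; exact: leq_maxr.
have Fg : F --> (g : {ptws J -> T}).
  apply/cvg_sup => j U [V [[W oW <-] Wg WU]].
  have [_ /(_ W) []] := hg j; first exact: open_nbhs_nbhs.
  move=> n hn; have [N hN] := agree_row j n; exists N => // h [b ab hb].
  exact/WU/(hn (row b j))/hb/hN.
move=> O /Fg[n _ sO]; exists n => b h ab hb; apply: sO; by exists b.
Qed.

Lemma borel_open (T : topologicalType) (A : set T) : open A -> borel A.
Proof. exact: sub_sigma_algebra. Qed.

Lemma borelT (T : topologicalType) : borel [set: T].
Proof. by apply: borel_open; exact: openT. Qed.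

Lemma borel0 (T : topologicalType) : borel (@set0 T).
Proof. by apply: borel_open; exact: open0. Qed.

Lemma borelC (T : topologicalType) (A : set T) : borel A -> borel (~` A).
Proof. by rewrite -setTD; exact: sigma_algebraCD. Qed.

Lemma borel_bigcup (T : topologicalType) (I : countType) (A : I -> set T) :
  (forall i, borel (A i)) -> borel (\bigcup_i A i).
Proof.
move=> bA; suff -> : \bigcup_i A i =
    \bigcup_n (if unpickle n is Some i then A i else set0).
  by apply: sigma_algebra_bigcup => n; case: unpickle => [i|];
    [exact: bA|exact: borel0].
apply/seteqP; split=> x [].
  by move=> i _ Ax; exists (pickle i) => //; rewrite pickleK.
by move=> n _; case: unpickle => [i Ai|//]; exists i.
Qed.

Lemma borel_bigcap (T : topologicalType) (I : countType) (A : I -> set T) :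
  (forall i, borel (A i)) -> borel (\bigcap_i A i).
Proof.
move=> bA; rewrite -[X in borel X]setCK setC_bigcap; apply: borelC.
by apply: borel_bigcup => i; exact: borelC.
Qed.

Lemma borel_preimage (S T : topologicalType) (h : S -> T) (A : set T) :
  continuous h -> borel A -> borel (h @^-1` A).
Proof.
move=> ch; apply: (@smallest_sub _ (sigma_algebra setT) _
  [set B | borel (h @^-1` B)]).
  split=> /=.
  - exact: borel0.
  - by move=> B bB; rewrite setTD preimage_setC; exact: borelC.
  - by move=> B bB; rewrite preimage_bigcup; exact: borel_bigcup.
by move=> O oO; apply: borel_open; apply: open_comp.
Qed.

(** The sets that are analytic together with their complement form a
sigma-algebra. It contains the open sets, as an open set is the union over n of
the closed sets of points at distance at least 1/(n+1) from its complement. *)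
Lemma borel_souslin (K : realType) (T : topologicalType) (A : set T) :
  polish K T -> borel A -> souslin A.
Proof.
move=> pT; have sT := souslin_polish pT.
have [_ [d [dm dN dcmp]]] := pT; have hT := compatible_metric_hausdorff dm dN.
have [d0 d0eq dC dT] := dm.
move=> bA; suff [] : souslin A /\ souslin (~` A) by [].
move: A bA; apply: (@smallest_sub _ (sigma_algebra setT) _
  [set B | souslin B /\ souslin (~` B)]).
  split=> /=.
  - rewrite setC0; split=> //; rewrite -(setIidr (@sub0set _ setT)).
    by apply: souslin_closed => //; exact: closed0.
  - by move=> B [sB sCB]; rewrite setTD setCK.
  - move=> B sB; split; first by apply: souslin_bigcup => n; case: (sB n).
    have -> : ~` (\bigcup_n B n) =
        [set z | setT z /\ forall n, True -> (~` B n) (id z)].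
      rewrite setC_bigcup; apply/seteqP; split=> z; first by move=> h; split.
      by move=> [_ h] n _; apply: h.
    apply: (@souslin_bigcap nat (fun=> True) T (fun=> T) setT (fun=> id)
      (fun n => ~` B n)).
    - exact: sT.
    - by [].
    - by move=> _ z; exact: cvg_id.
    - by move=> n _; case: (sB n).
move=> U oU; split; last first.
  rewrite -[X in souslin X]setTI; apply: souslin_closed => //.
  exact: open_closedC.
pose F n := [set x | forall y, ~ U y -> (n.+1%:R^-1 <= d x y)%R].
have -> : U = \bigcup_n (setT `&` F n).
  apply/seteqP; split=> x.
    move=> Ux; have /dN[e e0 eU] : nbhs x U by apply: open_nbhs_nbhs.
    exists (Num.truncn (e^-1)) => //; split=> // y nUy; apply: ltW.
    apply: lt_le_trans (_ : _ < e)%R _.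
      by rewrite invf_plt ?posrE ?ltr0n // truncnS_gt.
    by rewrite leNgt; apply/negP => /eU.
  move=> [n _ [_ Fx]]; apply: contrapT => /Fx; rewrite d0.
  by rewrite leNgt invr_gt0 ltr0n.
apply: souslin_bigcup => n; apply: souslin_closed => // x clx y nUy.
rewrite leNgt; apply/negP => dxy.
have : nbhs x [set w | (d x w < n.+1%:R^-1 - d x y)%R].
  by apply/dN; eexists; [|exact: subset_refl]; rewrite subr_gt0.
move=> /clx[w [/(_ y nUy) Fw /=]]; rewrite ltrBrDr dC => xw.
by have := lt_le_trans xw (le_trans Fw (dT _ x _)); rewrite ltxx.
Qed.

(** * Borel hulls of analytic sets without cycles *)

Definition acyclic (X : topologicalType) (R : set (X * X)) (A : set X) : Prop :=
  ~ exists (n : nat) (y : 'I_n.+1 -> X), is_cycle R A y.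

Lemma nbhs_open_sub (T : topologicalType) (x : T) (A : set T) : nbhs x A ->
  exists O, [/\ open O, O x & O `<=` A].
Proof. by rewrite nbhsE => -[O [oO Ox] OA]; exists O. Qed.

(** Lusin's separation argument, run on the n+1 vertices and the n+1 edges of a
cycle at once. Cut A and R into the pieces of the elements having a code with
prescribed first d digits. If no Borel sets separate, cutting one digit further
leaves a family of pieces that cannot be separated, so there are codes all of
whose initial segments give inseparable pieces. The points z i decoded from them
lie in A, hence some (z i, z (i+1)) differs from the decoded edge, and
disjoint neighbourhoods separate the pieces. *)
Lemma borel_hull_cycle (X : topologicalType) (R : set (X * X)) (A : set X) n :
  hausdorff_space X -> souslin R -> souslin A ->
  ~ (exists y : 'I_n.+1 -> X, is_cycle R A y) ->
  exists B, [/\ borel B, A `<=` B & ~ exists y : 'I_n.+1 -> X, is_cycle R B y].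
Proof.
move=> hX [CR cCR CRE] [CA cCA CAE] ncyc.
pose J := 'I_n.+1; pose K := {ffun J -> nat * nat}.
pose PA d (u : nat -> K) i := [set x | exists2 a,
  agree d (fun m => (u m i).1) a & CA a x].
pose PR d (u : nat -> K) i := [set e | exists2 a,
  agree d (fun m => (u m i).2) a & CR a e].
pose sep d u := exists B : J -> set X, [/\ forall i, borel (B i),
  forall i, PA d u i `<=` B i &
  forall x, (forall i, B i (x i)) -> (forall i, PR d u i (x i, x (ordS i))) ->
  False].
pose upd u d (k : K) : nat -> K := fun m => if m == d then k else u m.
(* The hulls for all ways [k] of prescribing digit [d] are combined as countable
   unions of countable intersections. *)
have sepS d u : (forall k, sep d.+1 (upd u d k)) -> sep d u.
  move=> /choice[B hB].
  exists (fun i => \bigcup_p \bigcap_(k in [set: K])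
    if (k i).1 == p then B k i else setT).
  split.
  - move=> i; apply: borel_bigcup => p; apply: borel_bigcap => k.
    by case: ifP => _; [have [] := hB k|exact: borelT].
  - move=> i x [a ua ax]; exists (a d) => // k _; case: eqP => // kd.
    have [_ + _] := hB k; apply; exists a => // m.
    rewrite ltnS leq_eqVlt /upd; case: eqP => [->|_ /= md]; first by rewrite kd.
    exact: ua.
  - move=> x xB xR; have /choice[p hp] : forall i, exists p : nat,
        forall k : K, (k i).1 = p -> B k i (x i).
      move=> i; have [p _ hp] := xB i; exists p => k kp.
      by have := hp k Logic.I; rewrite kp eqxx.
    have /choice[b hb] : forall i, exists b, agree d (fun m => (u m i).2) b /\
        CR b (x i, x (ordS i)).
      by move=> i; have [b] := xR i; exists b.
    pose k : K := [ffun i => (p i, b i d)].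
    have [_ _ /(_ x)] := hB k; apply=> i.
      by apply: hp; rewrite ffunE.
    have [ub bx] := hb i.
    exists (b i) => // m; rewrite ltnS leq_eqVlt /upd.
    case: eqP => [->|_ /= md]; first by rewrite ffunE.
    exact: ub.
apply: contrapT => nhull.
have nsep0 : ~ sep 0 (fun=> [ffun=> (0, 0)]).
  move=> [B [bB AB hB]]; apply: nhull; exists (\bigcap_i B i); split.
  - exact: borel_bigcap.
  - by move=> x /CAE[a ax] i _; apply: AB; exists a.
  - move=> [y [yB yR]]; apply: (hB y) => i; first exact: (yB i).
    by have /CRE[b bx] := yR i; exists b.
have /choice[phi hphi] : forall du : nat * (nat -> K), exists k : K,
    ~ sep du.1 du.2 ->
    ~ sep du.1.+1 (upd du.2 du.1 k).
  move=> [d u] /=; have [/sepS su|/existsNP[k nk]] :=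
    pselect (forall k, sep d.+1 (upd u d k)); last by exists k.
  by exists [ffun=> (0, 0)] => /(_ su).
(* [U d] prescribes inseparable pieces of depth [d], and [v] is their limit. *)
pose U := fix U d := if d is d'.+1 then upd (U d') d' (phi (d', U d'))
  else (fun=> [ffun=> (0, 0)]).
have nsepU d : ~ sep d (U d).
  by elim: d => [//|d IH]; exact: (hphi (d, U d) IH).
pose v m := phi (m, U m).
have Uv d m : m < d -> U d m = v m.
  elim: d => // d IH; rewrite ltnS leq_eqVlt /= /upd.
  by case: eqP => [->//|_ /=]; exact: IH.
have PAv d i x : PA d (U d) i x -> 
    exists a, agree d (fun m => (v m i).1) a /\ CA a x.
  by move=> [a ua ax]; exists a; split=> // m md; rewrite -(Uv d) //; apply: ua.
have PRv d i x : PR d (U d) i x -> 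
    exists a, agree d (fun m => (v m i).2) a /\ CR a x.
  by move=> [a ua ax]; exists a; split=> // m md; rewrite -(Uv d) //; apply: ua.
have /choice[z hz] : forall i, exists z : X, CA (fun m => (v m i).1) z /\
   forall O : set X, nbhs z O -> exists n, forall b z', 
     agree n (fun m => (v m i).1) b -> CA b z' -> O z'.
  move=> i; have [|z Cz zO] := cCA (fun m => (v m i).1); last by exists z.
  move=> d; apply: contrapT => nex; apply: (nsepU d).
  exists (fun j => if j == i then set0 else setT); split.
  - by move=> j; case: ifP => _; [exact: borel0|exact: borelT].
  - move=> j x; case: eqP => // -> /PAv[a [va ax]]; apply: nex.
    by exists a, x.
  - by move=> x /(_ i); rewrite eqxx.
have /choice[w hw] : forall i, exists z : X * X, CR (fun m => (v m i).2) z /\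
   forall O : set (X * X), nbhs z O -> exists n, forall b z', 
     agree n (fun m => (v m i).2) b -> CR b z' -> O z'.
  move=> i; have [|e Ce eO] := cCR (fun m => (v m i).2); last by exists e.
  move=> d; apply: contrapT => nex; apply: (nsepU d).
  exists (fun j => setT); split=> //; first by move=> j; exact: borelT.
  move=> x _ /(_ i)/PRv[a [va ax]]; apply: nex; by exists a, (x i, x (ordS i)).
(* Otherwise disjoint neighbourhoods would separate the pieces [U d] for a large
   depth [d]; it suffices to constrain vertex [j]. *)
have key i j (g : X * X -> X) : continuous g ->
    (forall x : J -> X, g (x i, x (ordS i)) = x j) -> g (w i) = z j.
  move=> cg gx; apply: (hausdorff_sep hX) => O V Og /nbhs_open_sub[W [oW Wz WV]].
  have [_ /(_ _ (cg _ _ Og))[m hm]] := hw i.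
  have [_ /(_ W (open_nbhs_nbhs (conj oW Wz)))[m' hm']] := hz j.
  apply: contrapT => nex; apply: (nsepU (maxn m m')).
  exists (fun l => if l == j then W else setT); split.
  - by move=> l; case: ifP => _; [exact: borel_open|exact: borelT].
  - move=> l x; case: eqP => // -> /PAv[a [va ax]]; apply: hm' ax.
    by apply: agreeS va; exact: leq_maxr.
  - move=> x /(_ j); rewrite eqxx => Wx /(_ i)/PRv[a [va ax]]; apply: nex.
    exists (x j); split; last exact: WV.
    rewrite -gx; apply: hm ax.
    by apply: agreeS va; exact: leq_maxl.
apply: ncyc; exists z; split=> i.
  by apply/CAE; exists (fun m => (v m i).1); have [] := hz i.
apply/CRE; exists (fun m => (v m i).2).
rewrite -(@key i i fst) //; last exact: continuous_fst.
rewrite -(@key i (ordS i) snd) //; last exact: continuous_snd.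
by rewrite -surjective_pairing; have [] := hw i.
Qed.

(** Having no cycle is a conjunction over the lengths of cycles, and the
intersection of the hulls for all lengths works. *)
Lemma borel_acyclic_hull (X : topologicalType) (R : set (X * X)) (A : set X) :
  hausdorff_space X -> souslin R -> souslin A -> acyclic R A ->
  exists B, [/\ borel B, A `<=` B & acyclic R B].
Proof.
move=> hX sR sA acA.
have /choice[B hB] : forall n, exists B, [/\ borel B, A `<=` B &
    ~ exists y : 'I_n.+1 -> X, is_cycle R B y].
  move=> n; apply: borel_hull_cycle => // -[y yA]; apply: acA; by exists n, y.
exists (\bigcap_n B n); split.
- by apply: borel_bigcap => n; have [] := hB n.
- by move=> x Ax n _; have [_ + _] := hB n; apply.
- move=> [n [y [yB yR]]]; have [_ _] := hB n; apply; exists y; split=> // i.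
  exact: (yB i).
Qed.

(** * Sigma-acyclic sets and minimal cycles *)

Definition sigma_acyclic (X : topologicalType) (R : set (X * X)) (B : set X) :=
  exists2 A : nat -> set X, forall n, borel (A n) /\ acyclic R (A n) &
    B = \bigcup_n A n.

Lemma acyclic0 (X : topologicalType) (R : set (X * X)) : acyclic R set0.
Proof. by move=> [n [y [/(_ ord0)]]]. Qed.

Lemma sigma_acyclic1 (X : topologicalType) (R : set (X * X)) (B : set X) :
  borel B -> acyclic R B -> sigma_acyclic R B.
Proof. by move=> bB aB; exists (fun=> B) => //; rewrite bigcup_const. Qed.

Lemma sigma_acyclic0 (X : topologicalType) (R : set (X * X)) :
  sigma_acyclic R set0.
Proof. by apply: sigma_acyclic1; [exact: borel0|exact: acyclic0]. Qed.

Lemma sigma_acyclic_borel (X : topologicalType) (R : set (X * X)) (B : set X) :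
  sigma_acyclic R B -> borel B.
Proof. by move=> [A hA ->]; apply: borel_bigcup => n; have [] := hA n. Qed.

Lemma sigma_acyclic_bigcup (X : topologicalType) (R : set (X * X))
    (I : countType) (B : I -> set X) :
  (forall i, sigma_acyclic R (B i)) -> sigma_acyclic R (\bigcup_i B i).
Proof.
move=> hB; have /choice[A hA] : forall i, exists A : nat -> set X,
    (forall n, borel (A n) /\ acyclic R (A n)) /\ B i = \bigcup_n A n.
  by move=> i; have [A] := hB i; exists A.
exists (fun k => if unpickle k is Some p then A p.1 p.2 else set0).
  move=> k; case: unpickle => [[i n]|]; first by have [] := hA i.
  by split; [exact: borel0|exact: acyclic0].
apply/seteqP; split=> x [].
  move=> i _; have [_ ->] := hA i => -[n _ Ax].
  by exists (pickle (i, n)) => //; rewrite pickleK.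
move=> k _; case: unpickle => // -[i n] /= Ax; exists i => //.
by have [_ ->] := hA i; exists n.
Qed.

Lemma sigma_acyclicU (X : topologicalType) (R : set (X * X)) (A B : set X) :
  sigma_acyclic R A -> sigma_acyclic R B -> sigma_acyclic R (A `|` B).
Proof.
move=> sA sB; rewrite (_ : _ `|` _ = \bigcup_(b in [set: bool]) if b then A else B).
  by apply: sigma_acyclic_bigcup => -[].
apply/seteqP; split=> x; first by move=> [?|?]; [exists true|exists false].
by move=> [[] _ ?]; [left|right].
Qed.

(** A cycle of least length in A is minimal, as a chord would give a shorter one:
if (y i, y j) is an edge with j different from i + 1, then the segment of the
cycle that goes from j to i is closed up by this edge. *)
Lemma minimal_cycle_in (X : topologicalType) (R : set (X * X)) (A : set X) :
  ~ acyclic R A ->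
  exists n (y : 'I_n.+1 -> X), is_cycle R A y /\ minimal_cycle R y.
Proof.
move=> /contrapT[n0 hn0].
pose P n := `[< exists y : 'I_n.+1 -> X, is_cycle R A y >].
have exP : exists n, P n by exists n0; apply/asboolP.
case: (ex_minnP exP) => n /asboolP[y yc] nmin; exists n, y; split=> //.
have [yA yR] := yc; split=> [|i j]; first by split.
split=> [Rij|->]; last exact: yR.
apply: contrapT => jN.
pose x (k : nat) : X := y (inord (k %% n.+1)).
have xR k : R (x k, x k.+1).
  have := yR (inord (k %% n.+1)); congr (R (_, y _)); apply: val_inj => /=.
  rewrite !inordK ?ltn_pmod //=.
  by rewrite -addn1 modnDml addn1.
have xE (k : 'I_n.+1) : x k = y k by rewrite /x modn_small // inord_val.
(* The number of steps from [j] to [i] along the cycle. *)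
pose k := (i + (n.+1 - j)) %% n.+1.
have kn : k < n.+1 by rewrite ltn_pmod.
have jk : j + k = i %[mod n.+1].
  rewrite modnDmr addnCA subnKC ?modnDr //; exact: ltnW.
have {}kn : k < n.
  rewrite ltnS leq_eqVlt in kn; case/orP: kn => [/eqP kn|//].
  exfalso; apply: jN; apply: val_inj => /=; move: jk; rewrite kn => jk.
  by rewrite -(addn1 i) -modnDml -jk modnDml addn1 -addnS modnDr modn_small.
have : n <= k; last by rewrite leqNgt kn.
apply: nmin; apply/asboolP; exists (fun t : 'I_k.+1 => x (j + t)); split.
  by move=> t; apply: yA.
move=> t; rewrite [nat_of_ord (ordS t)]/=; have := ltn_ord t.
rewrite ltnS leq_eqVlt => /orP[/eqP tk|tk].
  rewrite tk modnn addn0 xE.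
  suff -> : x (j + k) = y i by [].
  by rewrite -xE /x jk.
by rewrite modn_small // addnS; exact: xR.
Qed.

(** * Large sets of configurations *)

Section Construction.
Context {X : topologicalType} (R : set (X * X)).

Notation config := (seq nat -> X).
Notation edge := (seq nat * seq nat)%type.

(** A configuration places a point at every word, and a finite list of edges tells
which words are in use. Words are written in reverse, so that adding the
next coordinate of a word is a cons. A word s is recorded as a vertex by the
loop (s, s). *)
Definition avoids (L : seq edge) (B : set X) (g : config) : Prop :=
  forall p, p \in L -> ~ B (g p.1).

Definition large (L : seq edge) (D : set config) : Prop :=
  forall B, sigma_acyclic R B -> exists2 g, D g & avoids L B g.

Lemma large_sub (L : seq edge) (D D' : set config) :
  D `<=` D' -> large L D -> large L D'.
Proof. by move=> DD' h B /h[g /DD' ? ?]; exists g. Qed.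

(** The list of edges over a shape extended by m: m disjoint copies, told apart by
their new coordinate i, and a cycle through the m copies of the word e. *)
Definition extend_edges (m : nat) (e : seq nat) (L : seq edge) : seq edge :=
  [seq (i :: p.1, i :: p.2) | i <- iota 0 m, p <- L] ++
  [seq (i :: e, (i + 1) %% m :: e) | i <- iota 0 m].

Definition extend_configs (m : nat) (e : seq nat) (D : set config) : set config :=
  [set g | forall i, i < m ->
     D (fun s => g (i :: s)) /\ R (g (i :: e), g ((i + 1) %% m :: e))].

Lemma extend_edgesP m e L q : reflect
  ((exists i p, [/\ i < m, p \in L & q = (i :: p.1, i :: p.2)]) \/
   exists2 i, i < m & q = (i :: e, (i + 1) %% m :: e))
  (q \in extend_edges m e L).
Proof.
rewrite mem_cat; apply: (iffP orP) => -[].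
- move=> /allpairsP[[i p] /= [im pL ->]]; left; exists i, p.
  by rewrite mem_iota in im.
- by move=> /mapP[i im ->]; right; exists i => //; rewrite mem_iota in im.
- move=> [i [p [im pL ->]]]; left; apply/allpairsP; exists (i, p).
  by rewrite mem_iota.
- by move=> [i im ->]; right; apply/mapP; exists i => //; rewrite mem_iota.
Qed.

(** Choose for every m >= 2 failing the conclusion a sigma-acyclic set that meets all
the extended configurations, and let BB be their union. The values at e of the
members of D avoiding BB form an analytic set. A minimal cycle in it, with m
points, would assemble m such members into an extended configuration avoiding BB.
So this set lies in an acyclic Borel set, which together with BB meets all
members of D. *)
Lemma large_extend (L : seq edge) (D : set config) (e : seq nat) :
  hausdorff_space X -> is_digraph R -> souslin R ->
  (forall B, borel B -> souslin [set g e | g in [set g | D g /\ avoids L B g]]) ->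
  (e, e) \in L -> large L D ->
  exists m, [/\ 2 <= m, large (extend_edges m e L) (extend_configs m e D) &
    forall k, uniform_digraph k R -> m <= k + 1].
Proof.
move=> hX irrR sR sD eL lD; apply: contrapT => nex.
have /choice[B hB] : forall m, exists B, sigma_acyclic R B /\
    (2 <= m -> (forall k, uniform_digraph k R -> m <= k + 1) ->
     forall g, extend_configs m e D g -> ~ avoids (extend_edges m e L) B g).
  move=> m; apply: contrapT => nB; apply: nex.
  have m2 : 2 <= m.
    apply: contrapT => nm; apply: nB; exists set0; split=> //.
    exact: sigma_acyclic0.
  exists m; split=> //.
    move=> B sB; apply: contrapT => ng; apply: nB; exists B; split=> // _ _ g Dg gB.
    by apply: ng; exists g.
  move=> k uk; apply: contrapT => nk; apply: nB; exists set0; split=> //.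
    exact: sigma_acyclic0.
  by move=> _ /(_ k uk).
pose BB := \bigcup_m B m.
have sBB : sigma_acyclic R BB.
  by apply: sigma_acyclic_bigcup => m; have [] := hB m.
have [|C [bC AC aC]] := borel_acyclic_hull hX sR (sD _ (sigma_acyclic_borel sBB)).
  apply: contrapT => /minimal_cycle_in[n [y [[yA yR] ymin]]].
  have n_gt0 : 0 < n.
    case: n y yA yR {ymin} => // y _ /(_ ord0).
    by rewrite (_ : ordS ord0 = ord0) ?ord1 // => /irrR.
  have [_ /(_ n_gt0) hBn] := hB n.+1.
  have /choice[g hg] : forall i, exists g : config,
      (D g /\ avoids L BB g) /\ g e = y i.
    by move=> i; have [g] := yA i; exists g.
  pose G s := if s is i :: s' then g (inord i) s' else y ord0.
  apply: (hBn _ G).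
  - by move=> k uk; rewrite addn1 ltnS; exact: uk ymin.
  - move=> i im; have [[Dgi gia] gie] := hg (inord i); split=> //=.
    have i1m : (i + 1) %% n.+1 < n.+1 by rewrite ltn_pmod.
    have [_ ->] := hg (inord ((i + 1) %% n.+1)); rewrite gie.
    have := yR (inord i); congr (R (_, y _)); apply: val_inj => /=.
    by rewrite !inordK // addn1.
  - move=> p /extend_edgesP[[i [q [im qL -> /= Bq]]]|[i im -> /= Bq]].
    have [[_ ga] _] := hg (inord i); apply: (ga q qL); by exists n.+1.
  by have [[_ ga] _] := hg (inord i); apply: (ga _ eL); exists n.+1.
have [g Dg gB] := lD _ (sigma_acyclicU sBB (sigma_acyclic1 bC aC)).
apply: (gB _ eL); right; apply: AC; exists g => //; split=> // p pL Bp.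
by apply: (gB p pL); left.
Qed.

End Construction.

(** * Fixing digits of codes *)

Lemma mkseq_agree n a b : mkseq a n = mkseq b n <-> agree n a b.
Proof.
split=> [ab i im|ab]; first by rewrite -(nth_mkseq 0 a im) ab nth_mkseq.
apply: (@eq_from_nth _ 0); rewrite ?size_mkseq // => i im.
by rewrite !nth_mkseq // ab.
Qed.

Lemma take_mkseq m n (a : nat -> nat) :
  m <= n -> take m (mkseq a n) = mkseq a m.
Proof. by move=> mn; rewrite /mkseq -map_take take_iota (minn_idPl mn). Qed.

Lemma prefix_mkseq n (l : seq nat) a :
  prefix l (mkseq a n) -> mkseq a (size l) = l.
Proof.
move=> /[dup] /prefixP[t tE]; rewrite prefixE => /eqP <-.
have sl : size l <= n.
  by rewrite -(size_mkseq a n) tE size_cat leq_addr.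
by rewrite take_mkseq // size_mkseq.
Qed.

Lemma prefix_chain (l : nat -> seq nat) n0 :
  (forall n, n0 <= n -> size (l n) = n /\ prefix (l n) (l n.+1)) ->
  exists b, forall n, n0 <= n -> mkseq b n = l n.
Proof.
move=> hl.
have chain n m : n0 <= n -> n <= m -> prefix (l n) (l m).
  move=> n0n; elim: m => [|m IH].
    by rewrite leqn0 => /eqP->; exact: prefix_refl.
  rewrite leq_eqVlt => /orP[/eqP->|]; first exact: prefix_refl.
  move=> nm; apply: prefix_trans (IH nm) _.
  by have [_] := hl m (leq_trans n0n nm).
exists (fun i => nth 0 (l (maxn n0 i.+1)) i) => n n0n.
have [sn _] := hl n n0n.
apply: (@eq_from_nth _ 0); rewrite size_mkseq ?sn // => i iN.
rewrite nth_mkseq //.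
have mn : maxn n0 i.+1 <= n by rewrite geq_max n0n.
have /prefixP[t ->] := chain _ _ (leq_maxl n0 i.+1) mn.
rewrite nth_cat; case: ifP => //.
have [-> _] := hl _ (leq_maxl n0 i.+1).
by rewrite (leq_trans (ltnSn i)) // leq_maxr.
Qed.

(** The elements with a code that starts with l. *)
Definition piece (Z : topologicalType) (C : (nat -> nat) -> set Z) (l : seq nat)
  : set Z := [set z | exists2 a, mkseq a (size l) = l & C a z].

Lemma souslin_piece (Z : topologicalType) (C : (nat -> nat) -> set Z) l :
  complete_code C -> souslin (piece C l).
Proof.
move=> cC; exists (fun a z => mkseq a (size l) = l /\ C a z); last first.
  by move=> z; split=> [[a al Ca]|[a [al Ca]]]; exists a.
move=> a ha; have [|z Cz zO] := cC a.
  by move=> n; have [b [z [ab [_ Cb]]]] := ha n; exists b, z.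
exists z; last first.
  by move=> O /zO[n hn]; exists n => b z' ab [_]; exact: hn.
split=> //; have [b [_ [ab [bl _]]]] := ha (size l).
by rewrite -[RHS]bl; apply/mkseq_agree.
Qed.

(** Codes of the loops (x, x) by codes of x, so that vertices and edges can be
treated alike. *)
Definition diag_code (X : topologicalType) (C : (nat -> nat) -> set X)
  : (nat -> nat) -> set (X * X) := fun a z => C a z.1 /\ z.1 = z.2.

Lemma complete_diag_code (X : topologicalType) (C : (nat -> nat) -> set X) :
  complete_code C -> complete_code (diag_code C).
Proof.
move=> cC a ha; have [|x Cx xO] := cC a.
  by move=> n; have [b [z [ab [Cb _]]]] := ha n; exists b, z.1.
exists (x, x); first by [].
have dc : continuous (fun x : X => (x, x)).
  by apply: continuous_pair => y; exact: cvg_id.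
move=> O /dc /xO[n hn]; exists n => b [z1 z2] ab [/= Cb <-]; exact: hn ab Cb.
Qed.

(** Countable unions of sigma-acyclic sets are sigma-acyclic, so a large set cut
into countably many pieces has a large piece. This is done once for each of the
finitely many indices in M. *)
Lemma countable_choice_large (X : topologicalType) (R : set (X * X))
    (P : eqType) (Lab : countType) (l0 : Lab) (L : seq (seq nat * seq nat))
    (D : set (seq nat -> X)) (M : seq P) (Q : P -> Lab -> set (seq nat -> X)) :
  (forall g p, D g -> p \in M -> exists l, Q p l g) -> large R L D ->
  exists lab, large R L [set g | D g /\ forall p, p \in M -> Q p (lab p) g].
Proof.
elim: M => [|p M IH] hQ lD.
  by exists (fun=> l0); apply: large_sub lD.
have [|lab hlab] := IH _ lD.
  by move=> g q Dg qM; apply: hQ => //; rewrite inE qM orbT.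
have [pM|pM] := boolP (p \in M).
  exists lab; apply: large_sub hlab => g [Dg hg]; split=> // q.
  by rewrite inE => /orP[/eqP->|]; exact: hg.
have [l hl] : exists l, large R L [set g |
    (D g /\ forall p, p \in M -> Q p (lab p) g) /\ Q p l g].
  apply: contrapT => nl.
  have /choice[B hB] : forall l, exists B, sigma_acyclic R B /\
      forall g, (D g /\ forall p, p \in M -> Q p (lab p) g) -> Q p l g ->
        ~ avoids L B g.
    move=> l; apply: contrapT => nB; apply: nl; exists l => B sB.
    apply: contrapT => ng; apply: nB; exists B; split=> // g hg hQg gB.
    by apply: ng; exists g.
  have [|g hg gB] := hlab (\bigcup_l B l).
    by apply: sigma_acyclic_bigcup => l; have [] := hB l.
  have [l Ql] : exists l, Q p l g.
    by apply: hQ; [case: hg|rewrite inE eqxx].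
  have [_ /(_ g hg Ql)] := hB l; apply => q qL Bq; apply: (gB q qL).
  by exists l.
exists (fun q => if q == p then l else lab q).
apply: large_sub hl => g [[Dg hg] Ql]; split=> // q.
rewrite inE; case: eqP => [->//|_ /= qM]; exact: hg.
Qed.

(** * Cylinders of the space of branches *)

Definition cylinder (f : nat -> nat) (x : branches f) (n : nat)
  : set (branches f) := [set y : branches f | agree n (set_val x) (set_val y)].

Lemma nbhs_cylinder f (x : branches f) n : nbhs x (cylinder x n).
Proof.
suff h : nbhs (set_val x) [set y : baire_space | agree n (set_val x) y].
  exact: (@initial_continuous _ _ (set_val : branches f -> baire_space) x _ h).
elim: n => [|n IH]; first by apply: filterS (@filterT _ _ _).
have ev : nbhs (set_val x) [set y : baire_space | y n = set_val x n].
  apply: (@proj_continuous nat (fun=> nat) n (set_val x)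
    [set k | k = set_val x n]).
  exact: (discrete_set1 (set_val x n : discrete_topology nat)).
apply: filterS (filterI IH ev) => y [xy yn] i.
by rewrite ltnS leq_eqVlt => /orP[/eqP->|]; [rewrite yn|exact: xy].
Qed.

Lemma cylinder_nbhs f (x : branches f) (O : set (branches f)) :
  nbhs x O -> exists n, cylinder x n `<=` O.
Proof.
move=> [_ [[V oV <-] Vx VO]].
pose base n := [set y : baire_space | agree n (set_val x) y].
pose F := filter_from [set: nat] base.
have FF : Filter F.
  apply: filter_from_filter; first by exists 0.
  move=> m n _ _; exists (maxn m n) => // y xy.
  by split; apply: agreeS xy; [exact: leq_maxl|exact: leq_maxr].
have Fx : F --> (set_val x : baire_space).
  apply/cvg_sup => j U [W [[Z oZ <-] Zx ZU]].
  by exists j.+1 => // y xy; apply: ZU; rewrite /= -(xy j).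
have [n _ nV] : F V by apply: Fx; apply: open_nbhs_nbhs.
by exists n => y xy; apply: VO; apply: nV.
Qed.

(** * Stages of the construction *)

Lemma succ_mod_neq i m : 2 <= m -> i < m -> (i + 1) %% m != i.
Proof.
move=> m2; rewrite leq_eqVlt addn1 => /orP[/eqP im|im].
  by rewrite im modnn; apply/eqP => i0; move: m2; rewrite -im -i0.
by rewrite modn_small // neq_ltn ltnSn orbT.
Qed.

(** The list [shape] is f|n, and [label] gives the digits fixed so far in the code
of each vertex and each edge. *)
Record stage := Stage {
  shape : seq nat;
  edges : seq (seq nat * seq nat);
  label : seq nat * seq nat -> seq nat }.

Section Fusion.
Context {K : realType} {X : topologicalType} (R : set (X * X)).
Context (E : seq nat -> seq nat).
Context (CX : (nat -> nat) -> set X) (CR : (nat -> nat) -> set (X * X)).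
Hypotheses (pX : polish K X) (irrR : is_digraph R) (selE : selector E).
Hypotheses (cCX : complete_code CX) (CXE : forall x, exists a, CX a x).
Hypotheses (cCR : complete_code CR) (CRE : forall z, R z <-> exists a, CR a z).
Hypothesis nR : ~ sigma_acyclic R [set: X].

Notation config := (seq nat -> X).
Notation edge := (seq nat * seq nat)%type.

Let hX : hausdorff_space X.
Proof. by have [_ [d [dm dN _]]] := pX; exact: compatible_metric_hausdorff dm dN. Qed.

(** A pair with equal components is a vertex. As (i + 1) %% m differs from i for
m >= 2, the edges of G_0 never have equal endpoints. *)
Definition edge_code (p : edge) : (nat -> nat) -> set (X * X) :=
  if p.1 == p.2 then diag_code CX else CR.

Lemma complete_edge_code p : complete_code (edge_code p).
Proof. by rewrite /edge_code; case: ifP => // _; exact: complete_diag_code. Qed.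

Definition configs (S : stage) : set config :=
  [set g | forall p, p \in edges S -> piece (edge_code p) (label S p) (g p.1, g p.2)].

Definition target (S : stage) : seq nat := rev (E (shape S)).

Lemma souslin_configs S e B : borel B ->
  souslin [set g e | g in [set g | configs S g /\ avoids (edges S) B g]].
Proof.
move=> bB; have sX := souslin_polish pX.
have sP := @souslin_prod (seq nat) X sX.
have ev s : continuous (fun g : {ptws seq nat -> X} => g s).
  exact: (@proj_continuous (seq nat) (fun=> X) s).
have c1 (p : edge) :
    continuous (fun g : {ptws seq nat -> X} => (g p.1, g p.2)).
  exact: continuous_pair (ev p.1) (ev p.2).
have s1 := @souslin_bigcap edge (fun p => p \in edges S) _ (fun=> (X * X)%type)
  _ _ (fun p => piece (edge_code p) (label S p)) sP
  (fun=> hausdorff_prod hX hX) c1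
  (fun p _ => souslin_piece _ (@complete_edge_code p)).
have s2 := @souslin_bigcap edge (fun p => p \in edges S) _ (fun=> X)
  _ _ (fun p => ~` B) s1 (fun=> hX) (fun p => ev p.1)
  (fun p _ => borel_souslin pX (borelC bB)).
have := souslin_image (ev e) s2; congr souslin; apply/seteqP.
by split=> _ [g [h1 h2] <-]; exists g => //; split=> //; case: h1.
Qed.

Definition good (S : stage) : Prop :=
  [/\ calF_fin (shape S), large R (edges S) (configs S),
   forall s, T_fin (shape S) s -> (rev s, rev s) \in edges S &
   forall p, p \in edges S -> size (label S p) = size (shape S)].

Definition extendible (S : stage) (m : nat) : Prop := 2 <= m /\
  large R (extend_edges m (target S) (edges S))
    (extend_configs R m (target S) (configs S)).

(** The label an edge gets from the stage before: copies of an edge of S keep its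
label, and the edges of the new cycle start with no digit fixed. *)
Definition inherited (S : stage) (p : edge) : seq nat :=
  if p is (i :: s, j :: t) then if i == j then label S (s, t) else [::] else [::].

Definition step (S S' : stage) : Prop := exists m, [/\ extendible S m,
  (forall m', extendible S m' -> m <= m') /\
  (forall k, uniform_digraph k R -> m <= k + 1),
  shape S' = rcons (shape S) m,
  edges S' = extend_edges m (target S) (edges S) &
  forall p, p \in edges S' -> prefix (inherited S p) (label S' p)].

(** Take the least m for which the extension is large, then fix the first n+1
digits of the code of every vertex and edge so that largeness is kept. *)
Lemma exists_step S : good S -> exists2 S', good S' & step S S'.
Proof.
move=> [shS lS vS labS].
have tS : (target S, target S) \in edges S by apply/vS/selE.
have sR : souslin R by exists CR.
have [m0 [m02 lm0 um0]] :=
  large_extend hX irrR sR (fun B => @souslin_configs S (target S) B) tS lS.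
have exm : exists m, `[< extendible S m >] by exists m0; apply/asboolP.
case: (ex_minnP exm) => m /asboolP[m2 lm] mmin.
pose L := extend_edges m (target S) (edges S).
(* [l] is an admissible new label of [p] for the configuration [g]. *)
pose Q (p : edge) (l : seq nat) (g : config) := [/\ size l = (size (shape S)).+1,
  prefix (inherited S p) l & piece (edge_code p) l (g p.1, g p.2)].
have [|lab hlab] := @countable_choice_large _ R _ _ [::] L _ L Q _ lm.
  move=> g p Dg pL.
  suff [a al ga] : exists2 a, prefix (inherited S p) (mkseq a (size (shape S)).+1) &
      edge_code p a (g p.1, g p.2).
    exists (mkseq a (size (shape S)).+1); split=> //; first by rewrite size_mkseq.
    by exists a => //; rewrite size_mkseq.
  move: pL => /extend_edgesP[[i [q [im qL ->]]]|[i im ->]].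
    have [/(_ q qL)[a al ga] _] := Dg i im.
    exists a.
      by rewrite mkseqS -(labS q) // al /inherited eqxx
        -surjective_pairing prefix_rcons.
    by move: ga; rewrite /edge_code /= eqseq_cons eqxx.
  have ni : (i == (i + 1) %% m) = false.
    by rewrite eq_sym; apply/negbTE; exact: succ_mod_neq.
  have [_ /CRE[a ga]] := Dg i im; exists a; first by rewrite /= ni.
  by rewrite /edge_code /= eqseq_cons ni.
have Qlab p : p \in L -> size (lab p) = (size (shape S)).+1 /\
    prefix (inherited S p) (lab p).
  have [g [_ /(_ p) Qp] _] := hlab _ (sigma_acyclic0 R).
  by move=> /Qp[].
exists (Stage (rcons (shape S) m) L lab).
  split=> /=.
  - move=> k; rewrite size_rcons ltnS leq_eqVlt nth_rcons.
    case/orP => [/eqP->|kS]; first by rewrite ltnn eqxx.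
    by rewrite kS; exact: shS.
  - by apply: large_sub hlab => g [_ hg] p /hg[].
  - move=> s [ss hs]; rewrite size_rcons in ss hs.
    case/lastP: s ss hs => // s i; rewrite size_rcons => -[ss] hs.
    rewrite rev_rcons; apply/extend_edgesP; left.
    exists i, (rev s, rev s); split=> //.
      by have := hs _ (ltnSn _); rewrite !nth_rcons -ss ltnn eqxx.
    apply: vS; split=> // k kS.
    by have := hs k (leqW kS); rewrite !nth_rcons ss kS.
  - by move=> p /Qlab[-> _]; rewrite size_rcons.
exists m; split=> //=; last by move=> p /Qlab[].
split=> [m' hm'|k uk]; first by apply: mmin; apply/asboolP.
by apply: leq_trans (um0 k uk); apply: mmin; apply/asboolP.
Qed.

(** * The limit shape and its monotonicity *)

Definition root : stage := Stage [::] [:: ([::], [::])] (fun=> [::]).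

Lemma good_root : good root.
Proof.
split=> //.
- move=> B sB; apply: contrapT => ng; apply: nR.
  suff -> : [set: X] = B by [].
  apply/seteqP; split=> // x _; apply: contrapT => nBx; apply: ng.
  exists (fun=> x) => // p; rewrite inE => /eqP ->.
  by have [a ax] := CXE x; exists a.
- by move=> [|? ?] [].
Qed.

Lemma exists_stages : exists2 S : nat -> stage,
  S 0 = root & forall n, good (S n) /\ step (S n) (S n.+1).
Proof.
have next (S : {S | good S}) : {S' : {S | good S} | step (sval S) (sval S')}.
  apply: cid; have [S' gS' sS'] := exists_step (svalP S).
  by exists (exist _ S' gS').
have [S [S0 hS]] := dependent_choice next (exist _ root good_root).
exists (fun n => sval (S n)); first by rewrite S0.
by move=> n; split; [exact: svalP|exact: hS].
Qed.

Section Limit.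
Context (S : nat -> stage).
Hypotheses (S0 : S 0 = root) (gS : forall n, good (S n)).
Hypothesis stS : forall n, step (S n) (S n.+1).

Definition limit_shape (n : nat) : nat := last 0 (shape (S n.+1)).
Local Notation f := limit_shape.

Lemma limit_step n : [/\ extendible (S n) (f n),
  (forall m', extendible (S n) m' -> f n <= m') /\
  (forall k, uniform_digraph k R -> f n <= k + 1),
  shape (S n.+1) = rcons (shape (S n)) (f n),
  edges (S n.+1) = extend_edges (f n) (target (S n)) (edges (S n)) &
  forall p, p \in edges (S n.+1) ->
    prefix (inherited (S n) p) (label (S n.+1) p)].
Proof.
have [m [h1 h2 h3 h4 h5]] := stS n.
by rewrite /limit_shape h3 last_rcons; split=> //; rewrite -h3.
Qed.

Lemma shapeE n : shape (S n) = restr f n.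
Proof.
elim: n => [|n IH]; first by rewrite S0.
by have [_ _ -> _ _] := limit_step n; rewrite IH /restr mkseqS.
Qed.

Lemma size_shape n : size (shape (S n)) = n.
Proof. by rewrite shapeE size_mkseq. Qed.

Lemma calF_limit : calF f.
Proof. by move=> n; have [[]] := limit_step n. Qed.

Lemma size_label n p : p \in edges (S n) -> size (label (S n) p) = n.
Proof. by have [_ _ _ h] := gS n => /h ->; exact: size_shape. Qed.

Lemma size_target n : size (target (S n)) = n.
Proof.
rewrite /target size_rev; have [cF _ _ _] := gS n.
by have [-> _] := selE cF; exact: size_shape.
Qed.

Lemma edges_cons n i p : i < f n -> p \in edges (S n) ->
  (i :: p.1, i :: p.2) \in edges (S n.+1).
Proof.
move=> im pS; have [_ _ _ -> _] := limit_step n.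
by apply/extend_edgesP; left; exists i, p.
Qed.

Lemma label_cons n i p : i < f n -> p \in edges (S n) ->
  prefix (label (S n) p) (label (S n.+1) (i :: p.1, i :: p.2)).
Proof.
move=> im pS; have [_ _ _ _ /(_ _ (edges_cons im pS))] := limit_step n.
by rewrite /= eqxx -surjective_pairing.
Qed.

(** Each of the f(n) copies inside a configuration of stage n+1 is a configuration
of stage n. *)
Lemma configs_cons n i g : i < f n -> configs (S n.+1) g ->
  configs (S n) (fun s => g (i :: s)).
Proof.
move=> im gC p pS; have pS' := edges_cons im pS.
have [a al ga] := gC _ pS'; exists a.
  apply: (@prefix_mkseq n.+1); rewrite -(size_label pS') al.
  exact: label_cons.
by move: ga; rewrite /edge_code /= eqseq_cons eqxx.
Qed.

(** The reversed words over f(n), ..., f(n+j-1): these single out the copies of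
stage n inside stage n+j. *)
Definition address n j (w : seq nat) : Prop :=
  size w = j /\ forall k, k < j -> nth 0 w k < f (n + (j - k.+1)).

Lemma address_cons n j i w : address n j.+1 (i :: w) ->
  i < f (n + j) /\ address n j w.
Proof.
move=> [[sw] hw]; split; first by have := hw 0 isT; rewrite subn1.
by split=> // k kj; exact: (hw k.+1).
Qed.

Lemma configs_cat n j w g : address n j w -> configs (S (n + j)) g ->
  configs (S n) (fun s => g (w ++ s)).
Proof.
elim: j w g => [|j IH] [|i w] g; rewrite ?addn0 //; try by case.
move=> /address_cons[im aw]; rewrite addnS => gC.
exact: (IH w (fun s => g (i :: s)) aw (configs_cons im gC)).
Qed.

Lemma edges_cat n j w p : address n j w -> p \in edges (S n) ->
  (w ++ p.1, w ++ p.2) \in edges (S (n + j)).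
Proof.
elim: j w => [|j IH] [|i w]; rewrite ?addn0 //; try by case.
  by rewrite -surjective_pairing.
move=> /address_cons[im aw] pS; rewrite addnS.
exact: (edges_cons im (IH w aw pS)).
Qed.

(** Write E(f|n) as E(f|m) followed by u. In an extended configuration of stage n,
restrict each of the f(n) parts to the words ending in u: this gives
configurations of stage m, joined by the same cycle at E(f|m). So f(n) is
among the numbers of which f(m) is the least. *)
Lemma extendible_prefix n m : prefix (E (restr f m)) (E (restr f n)) ->
  extendible (S m) (f n).
Proof.
move=> /prefixP[u uE].
have tE k : target (S k) = rev (E (restr f k)) by rewrite /target shapeE.
have mn : m <= n.
  by rewrite -(size_target n) -(size_target m) !tE !size_rev uE size_cat leq_addr.
pose j := n - m; have nE : m + j = n by rewrite subnKC.
have tnm : target (S n) = rev u ++ target (S m) by rewrite !tE uE rev_cat.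
have su : size u = j.
  by have := size_target n; rewrite tnm size_cat size_rev size_target -nE
    addnC => /addnI.
have au : address m j (rev u).
  split=> [|k kj]; first by rewrite size_rev.
  rewrite nth_rev ?su //.
  have [cF _ _ _] := gS n; have [_ /(_ (m + (j - k.+1)))] := selE cF.
  have kn : m + (j - k.+1) < n.
    by rewrite -[X in _ < X]nE ltn_add2l ltn_subrL (leq_trans _ kj).
  rewrite size_shape => /(_ kn); rewrite !shapeE uE.
  rewrite [X in _ < X]nth_mkseq // nth_cat.
  have -> : size (E (restr f m)) = m by have := size_target m; rewrite tE size_rev.
  have -> : (m + (j - k.+1) < m) = false by rewrite ltnNge leq_addr.
  by rewrite addKn.
have [[fn2 lfn] _ _ _ _] := limit_step n; split=> // B /lfn[g gD gB].
exists (fun s => if s is i :: s' then g (i :: rev u ++ s') else g [::]).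
  move=> i im; have [gi Ri] := gD i im; split.
    by apply: (configs_cat (g := fun s => g (i :: s)) au); rewrite nE.
  by rewrite -tnm.
move=> p /extend_edgesP[[i [q [im qS -> /=]]]|[i im -> /=]].
  apply: (gB (i :: rev u ++ q.1, i :: rev u ++ q.2)).
  apply/extend_edgesP; left; exists i, (rev u ++ q.1, rev u ++ q.2); split=> //.
  by rewrite -[in S n]nE; exact: edges_cat.
rewrite -tnm; apply: (gB (i :: target (S n), (i + 1) %% f n :: target (S n))).
by apply/extend_edgesP; right; exists i.
Qed.

Lemma limit_monotone : selector_monotone E f.
Proof.
move=> n m /extendible_prefix; have [_ [fmin _] _ _ _] := limit_step m.
exact: fmin.
Qed.

(** * The limit homomorphism *)

Definition address_of (x : branches f) (n : nat) : seq nat :=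
  rev (mkseq (set_val x) n).

Lemma address_ofS x n : address_of x n.+1 = set_val x n :: address_of x n.
Proof. by rewrite /address_of mkseqS rev_rcons. Qed.

Lemma branch_lt (x : branches f) n : set_val x n < f n.
Proof. exact: (set_valP x n). Qed.

Lemma edges_diag x n : (address_of x n, address_of x n) \in edges (S n).
Proof.
have [_ _ h _] := gS n; apply: h; split; first by rewrite size_mkseq size_shape.
move=> k; rewrite size_shape => kn; rewrite shapeE !nth_mkseq //.
exact: branch_lt.
Qed.

Lemma config_ex n : exists g, configs (S n) g.
Proof.
by have [_ /(_ _ (sigma_acyclic0 R))[g gC _] _ _] := gS n; exists g.
Qed.

(** From stage n0 on, the restrictions of x and y form an edge, and the digits
fixed for it form the code b of an element z. Used for a branch paired with
itself, where n0 = 0, and for the edges of G_0, which appear at stage l+1. *)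
Lemma edge_limit (x y : branches f) (n0 : nat) (C : (nat -> nat) -> set (X * X)) :
  complete_code C ->
  (forall n, n0 <= n -> set_val x n = set_val y n) ->
  (forall n, n0 <= n -> edge_code (address_of x n, address_of y n) = C) ->
  (address_of x n0, address_of y n0) \in edges (S n0) ->
  exists b z, [/\
    forall n, n0 <= n -> mkseq b n = label (S n) (address_of x n, address_of y n),
    forall n, n0 <= n -> (address_of x n, address_of y n) \in edges (S n),
    C b z &
    forall O, nbhs z O -> exists n, forall b' z', agree n b b' -> C b' z' -> O z'].
Proof.
move=> cC xy CE e0.
have eN n : n0 <= n -> (address_of x n, address_of y n) \in edges (S n).
  elim: n => [|n IH]; first by rewrite leqn0 => /eqP n00; rewrite -n00.
  rewrite leq_eqVlt => /orP[/eqP <-//|n0n].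
  rewrite !address_ofS -(xy n n0n); apply: edges_cons (IH n0n); exact: branch_lt.
have [|b hb] := @prefix_chain
    (fun n => label (S n) (address_of x n, address_of y n)) n0.
  move=> n n0n; split; first exact: size_label (eN n n0n).
  rewrite !address_ofS -(xy n n0n); apply: label_cons (eN n n0n).
  exact: branch_lt.
have [|z Cz zO] := cC b; last by exists b, z.
move=> n; have [g /(_ _ (eN _ (leq_maxl n0 n)))[a]] := config_ex (maxn n0 n).
rewrite (size_label (eN _ (leq_maxl n0 n))) -hb ?leq_maxl // CE ?leq_maxl //.
move=> /mkseq_agree ab ga.
by exists a, (g (address_of x (maxn n0 n)), g (address_of y (maxn n0 n)));
  split=> // i iN; rewrite ab // (leq_trans iN) // leq_maxr.
Qed.

Definition is_limit (x : branches f) (u : X) : Prop := exists a, [/\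
  forall n, mkseq a n = label (S n) (address_of x n, address_of x n), CX a u &
  forall O, nbhs u O -> exists n, forall b u', agree n a b -> CX b u' -> O u'].

Lemma exists_limit x : exists u, is_limit x u.
Proof.
have [|||b [[u v] [bE _ [/= Cu _] hO]]] :=
  @edge_limit x x 0 _ (complete_diag_code cCX).
- by [].
- by move=> n _; rewrite /edge_code eqxx.
- exact: edges_diag.
exists u, b; split=> // [n|O Ou]; first exact: bE.
have [|n hn] := hO (fst @^-1` O); first exact: (@continuous_fst _ _ (u, v) _ Ou).
by exists n => b' u' bb' Cu'; exact: (hn b' (u', u') bb').
Qed.


(** The images of two branches that share n coordinates have codes that share n
digits, which gives continuity. The element of R decoded along an edge of G_0 has
the images of the endpoints as components: configurations of late stages come
close to both, and X is Hausdorff. *)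
Lemma limit_hom : continuous_hom_from_G0 R E f.
Proof.
have /choice[h hh] := exists_limit; exists h; split.
  move=> x O /=; have [a [aE Ca aO]] := hh x => /aO[n hn].
  apply: filterS (nbhs_cylinder x n) => y xy.
  have [b [bE Cb _]] := hh y; apply: hn Cb; apply/mkseq_agree.
  rewrite aE bE /address_of; suff -> : mkseq (set_val y) n = mkseq (set_val x) n by [].
  by apply/mkseq_agree => i iN; rewrite xy.
move=> y z [l [x [/= zl yE zE]]].
have eE : rev (E (restr f l)) = target (S l) by rewrite /target shapeE.
have sE : size (E (restr f l)) = l.
  by rewrite -{2}(size_target l) -eE size_rev.
(* Both endpoints of the edge pass through [E (f|l)] and share their tail. *)
have val_at (w : branches f) : (set_val w : nat -> nat) =
    concat (rcons (E (restr f l)) (set_val w l)) x ->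
    address_of w l = target (S l) /\ forall n, l < n -> set_val w n = x (n - l.+1).
  move=> wE; split.
    rewrite -eE /address_of; congr rev.
    apply: (@eq_from_nth _ 0); rewrite ?size_mkseq // => i il.
    by rewrite nth_mkseq // wE /concat size_rcons sE (leqW il) nth_rcons sE il.
  by move=> n ln; rewrite wE /concat size_rcons sE ltnNge ln.
have [yl yt] := val_at y yE; have [zl' zt] := val_at z zE.
have yz : set_val y l != set_val z l.
  rewrite zl eq_sym succ_mod_neq ?branch_lt //; exact: calF_limit.
have neqN n : l < n -> address_of y n != address_of z n.
  move=> ln; apply/eqP => yzn; case/eqP: yz; have := congr1 rev yzn.
  by rewrite !revK => /(congr1 (fun s => nth 0 s l)); rewrite !nth_mkseq.
have [|||b [[u v] [bE eN Cuv hO]]] := @edge_limit y z l.+1 CR cCR.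
- by move=> n ln; rewrite yt // zt.
- by move=> n ln; rewrite /edge_code (negPf (neqN n ln)).
- rewrite !address_ofS yl zl' zl.
  have [_ _ _ -> _] := limit_step l; apply/extend_edgesP; right.
  by exists (set_val y l) => //; exact: branch_lt.
have key (pr : X * X -> X) (w : branches f) : continuous pr ->
    (forall (g : config) n, pr (g (address_of y n), g (address_of z n)) =
       g (address_of w n)) -> pr (u, v) = h w.
  move=> cpr prE; apply: (hausdorff_sep hX) => O V /cpr /hO[n1 hn1].
  have [a [aE Ca aO]] := hh w; move=> /aO[n2 hn2].
  pose N := maxn l.+1 (maxn n1 n2).
  have lN : l < N by exact: leq_maxl.
  have [g gC] := config_ex N; exists (g (address_of w N)); split.
    rewrite -prE; have [c] := gC _ (eN N lN).
    rewrite (size_label (eN N lN)) -bE // => /mkseq_agree bc.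
    rewrite /edge_code (negPf (neqN N lN)) => Cc; apply: hn1 Cc.
    by move=> i iN; rewrite bc // (leq_trans iN) // !leq_max leqnn !orbT.
  have [c] := gC _ (edges_diag w N).
  rewrite (size_label (edges_diag w N)) -aE => /mkseq_agree ac.
  rewrite /edge_code eqxx => -[/= Cc _]; apply: hn2 Cc.
  by move=> i iN; rewrite ac // (leq_trans iN) // !leq_max leqnn !orbT.
rewrite -(key fst y) //; last exact: continuous_fst.
rewrite -(key snd z) //; last exact: continuous_snd.
by apply/CRE; exists b.
Qed.

End Limit.

End Fusion.

(** * Selectors with dense values and Baire category *)

Lemma injective_unbounded (g : nat -> nat) N : injective g -> exists i, N <= g i.
Proof.
move=> gI; apply: contrapT => /forallNP gN.
have {}gN i : g i < N by rewrite ltnNge; apply/negP.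
have /leq_card : injective (fun i : 'I_N.+1 => Ordinal (gN i)).
  by move=> i j /(congr1 val) /= /gI; exact: val_inj.
by rewrite !card_ord ltnn.
Qed.

Definition in_tree (f : nat -> nat) (s : seq nat) : Prop :=
  forall k, k < size s -> nth 0 s k < f k.

Definition dense_selector (E : seq nat -> seq nat) : Prop :=
  forall f s, calF f -> in_tree f s -> exists l, prefix s (E (restr f l)).

(** The value at a sequence of length n is the word enumerated at n, truncated or
padded to length n and with the entries that are too large replaced by 0. Each
word s is enumerated infinitely often, thanks to the second component of the
enumerated pairs, hence at some n that is at least the length of s. *)
Lemma exists_dense_selector : exists2 E, selector E & dense_selector E.
Proof.
pose word n := if unpickle n is Some p then (p : seq nat * nat).1 else [::].
pose entry (sg : seq nat) k := let a := nth 0 (word (size sg)) k in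
  if a < nth 0 sg k then a else 0.
exists (fun sg => mkseq (entry sg) (size sg)).
  move=> sg sgF; split; first by rewrite size_mkseq.
  move=> k kS; rewrite nth_mkseq // /entry; case: ifP => // _.
  exact: leq_trans (sgF k kS).
move=> f s fF sT.
have [i si] : exists i : nat, size s <= pickle (s, i).
  apply: (@injective_unbounded (fun i => pickle (s, i)) (size s)).
  by move=> i j /(pcan_inj pickleK)[].
exists (pickle (s, i)); set n := pickle (s, i) in si *.
rewrite /restr size_mkseq prefixE; apply/eqP.
apply: (@eq_from_nth _ 0); rewrite size_takel ?size_mkseq // => k ks.
rewrite nth_take // nth_mkseq ?(leq_trans ks) // /entry size_mkseq /word pickleK /=.
by rewrite nth_mkseq ?(leq_trans ks) // sT.
Qed.

Definition dense_words (f : nat -> nat) (D : set (seq nat)) : Prop :=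
  forall s, in_tree f s -> exists t, [/\ in_tree f t, prefix s t & D t].

Definition generic (D : nat -> set (seq nat)) (x : nat -> nat) : Prop :=
  forall n, exists m, D n (mkseq x m).

Lemma in_tree_cat f s t : in_tree f (s ++ t) <->
  in_tree f s /\ in_tree (fun k => f (size s + k)) t.
Proof.
split=> [h|[hs ht] k].
  split=> k kS.
    by have := h k; rewrite size_cat nth_cat kS; apply; rewrite ltn_addr.
  have := h (size s + k); rewrite size_cat ltn_add2l nth_cat => /(_ kS).
  have -> : (size s + k < size s) = false by rewrite ltnNge leq_addr.
  by rewrite addKn.
rewrite size_cat nth_cat; case: (ltnP k (size s)) => [kS _|kS kT]; first exact: hs.
have := ht (k - size s); rewrite subnKC //; apply.
by rewrite ltn_subLR.
Qed.

Lemma exists_generic f D : (forall k, 0 < f k) ->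
  (forall n, dense_words f (D n)) ->
  exists2 x, forall k, x k < f k & generic D x.
Proof.
move=> f0 dD.
have /choice[phi hphi] : forall ns : nat * seq nat, exists t, in_tree f ns.2 ->
    [/\ in_tree f t, prefix (rcons ns.2 0) t & D ns.1 t].
  move=> [n s] /=; have [sT|] := pselect (in_tree f s); last by exists [::].
  have [|t ht] := dD n (rcons s 0); last by exists t.
  rewrite -cats1; apply/in_tree_cat; split=> // -[|//] _ /=; exact: f0.
pose s := fix s n := if n is n'.+1 then phi (n', s n') else [::].
have sT n : in_tree f (s n).
  by elim: n => // n IH; have [] := hphi (n, s n) IH.
have sS n : prefix (rcons (s n) 0) (s n.+1) by have [] := hphi (n, s n) (sT n).
have sz n : n <= size (s n).
  elim: n => // n IH; have /prefixP[t ->] := sS n.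
  by rewrite size_cat size_rcons (leq_ltn_trans IH) // leq_addr.
have chain n m : n <= m -> prefix (s n) (s m).
  elim: m => [|m IH]; first by rewrite leqn0 => /eqP->; exact: prefix_refl.
  rewrite leq_eqVlt => /orP[/eqP->|/IH h]; first exact: prefix_refl.
  exact: prefix_trans h (prefix_trans (prefix_rcons _ _) (sS m)).
have nthE n m i : n <= m -> i < size (s n) -> nth 0 (s m) i = nth 0 (s n) i.
  by move=> /chain/prefixP[t ->] iN; rewrite nth_cat iN.
pose x k := nth 0 (s k.+1) k.
have xE n : mkseq x (size (s n)) = s n.
  apply: (@eq_from_nth _ 0); rewrite size_mkseq // => i iN; rewrite nth_mkseq //.
  case: (leqP n i.+1) => ni; first by rewrite /x (nthE n).
  by rewrite /x -(nthE i.+1 n) ?sz // ltnW.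
exists x => [k|n]; first exact/sT/sz.
exists (size (s n.+1)); rewrite xE; by have [] := hphi (n, s n) (sT n).
Qed.

(** Comeagerness of A in the cone below s, with dense open sets given by dense sets
of words. *)
Definition comeager_on f (A : set (branches f)) (s : seq nat) : Prop :=
  exists2 D, forall n, dense_words f (D n) &
    forall x : branches f, mkseq (set_val x) (size s) = s ->
      generic D (set_val x) -> A x.

Definition baire_property f (A : set (branches f)) : Prop :=
  forall s, in_tree f s -> exists t, [/\ in_tree f t, prefix s t &
    comeager_on A t \/ comeager_on (~` A) t].

Lemma branch_mkseq f (x : branches f) n : in_tree f (mkseq (set_val x) n).
Proof.
move=> k; rewrite size_mkseq => kn; rewrite nth_mkseq //; exact: (set_valP x k).
Qed.

(** If no A n is comeager in a cone below s, then by the Baire property every cone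
below s contains a cone where A n is meager. The words t with A n meager below t
are thus dense below s, and a branch below s that is generic for them and for the
dense sets witnessing each such meagerness is in no A n. *)
Lemma comeager_on_bigcup f (A : nat -> set (branches f)) s :
  (forall k, 0 < f k) -> in_tree f s -> (forall n, baire_property (A n)) ->
  (exists n t, [/\ in_tree f t, prefix s t & comeager_on (A n) t]) \/
  comeager_on (~` \bigcup_n A n) s.
Proof.
move=> f0 sT bA.
have [|nex] := pselect (exists n t, [/\ in_tree f t, prefix s t & comeager_on (A n) t]).
  by left.
right.
have /choice[D hD] : forall nt : nat * seq nat, exists D : nat -> set (seq nat),
    (forall i, dense_words f (D i)) /\ (comeager_on (~` A nt.1) nt.2 ->
    forall x : branches f, mkseq (set_val x) (size nt.2) = nt.2 ->
      generic D (set_val x) -> (~` A nt.1) x).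
  move=> [n t] /=; have [[D dD DA]|nc] := pselect (comeager_on (~` A n) t).
    by exists D.
  by exists (fun=> setT); split=> // i r rT; exists r; rewrite prefix_refl.
pose D0 n := [set t | size s <= size t /\
  (prefix s t -> comeager_on (~` A n) t)].
pose DD k := match unpickle k with
  | Some (inl n) => D0 n
  | Some (inr (nt, i)) => D nt i
  | None => setT
  end.
exists DD => [k|x xs gx [n _ Anx]].
  rewrite /DD; case: unpickle => [[n|[nt i]]|].
  (* Padding makes r1 at least as long as s, so either r1 extends s or no
     extension of r1 does. *)
  - move=> r rT; pose r1 := r ++ nseq (size s) 0.
    have r1T : in_tree f r1.
      apply/in_tree_cat; split=> // j; rewrite size_nseq => js.
      by rewrite nth_nseq js.
    have sr1 : size s <= size r1 by rewrite size_cat size_nseq leq_addl.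
    have rr1 : prefix r r1 by exact: prefix_prefix.
    have [sp|/negP sp] := boolP (prefix s r1); last first.
      by exists r1; split=> //; split.
    have [t [tT r1t [cA|cA]]] := bA n r1 r1T.
      exfalso; apply: nex; exists n, t; split=> //; exact: prefix_trans r1t.
    exists t; split=> //; first exact: prefix_trans r1t.
    split=> //; have /prefixP[u ->] := r1t.
    by rewrite size_cat (leq_trans sr1) // leq_addr.
  - by have [h _] := hD nt; exact: h.
  - by move=> r rT; exists r; rewrite prefix_refl.
have [m] := gx (pickle (inl n : nat + (nat * seq nat) * nat)%type).
rewrite /DD pickleK => -[]; rewrite size_mkseq => sm.
have px : prefix s (mkseq (set_val x) m).
  by rewrite prefixE take_mkseq // xs.
move=> /(_ px) cm; have [_ /(_ cm x)] := hD (n, mkseq (set_val x) m).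
rewrite /= size_mkseq => /(_ erefl); apply=> //= i.
have [m'] := gx (pickle
  (inr ((n, mkseq (set_val x) m), i) : nat + (nat * seq nat) * nat)%type).
by rewrite /DD pickleK; exists m'.
Qed.

(** The sets with this property form a sigma-algebra containing the open sets. *)
Lemma borel_baire_property f (A : set (branches f)) :
  (forall k, 0 < f k) -> borel A -> baire_property A.
Proof.
move=> f0; have triv s B :
    (forall x : branches f, mkseq (set_val x) (size s) = s -> B x) ->
    @comeager_on f B s.
  move=> h; exists (fun=> setT) => [n r rT|x xs _]; last exact: h.
  by exists r; rewrite prefix_refl.
move: A; apply: (@smallest_sub _ (sigma_algebra setT) _ (@baire_property f)).
  split.
  - move=> s sT; exists s; split; [by []|exact: prefix_refl|].
    by right; apply: triv => x _ [].
  - move=> B bB s /bB[t [tT st h]]; exists t; split=> //.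
    by rewrite setTD setCK; case: h => h; [right|left].
  - move=> B bB s sT; have [[n [t [tT st [D dD DB]]]]|h] := comeager_on_bigcup f0 sT bB.
      by exists t; split=> //; left; exists D => // x xt gx; exists n => //; exact: DB.
    by exists s; split; [|exact: prefix_refl|right].
move=> O oO s sT.
have [[x [Ox xs]]|nO] := pselect (exists x, O x /\ mkseq (set_val x) (size s) = s).
  have [n nO] := cylinder_nbhs (open_nbhs_nbhs (conj oO Ox)).
  have ms : size s <= maxn n (size s) by exact: leq_maxr.
  exists (mkseq (set_val x) (maxn n (size s))); split.
  - exact: branch_mkseq.
  - by rewrite prefixE take_mkseq // xs.
  - left; apply: triv => y; rewrite size_mkseq => /mkseq_agree yx.
    by apply: nO => i iN; rewrite yx // (leq_trans iN) // leq_maxl.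
exists s; split; [by []|exact: prefix_refl|right].
by apply: triv => x xs Ox; apply: nO; exists x.
Qed.

(** The set A n whose preimage is comeager in the cone of e contains the images of
the f(l) branches e i x for a single generic x: genericity of e i x for all i at
once is genericity of x for the countably many dense sets [D']. *)
Lemma no_hom_from_dense_G0 (X : topologicalType) (R : set (X * X)) E f :
  selector E -> dense_selector E -> calF f -> continuous_hom_from_G0 R E f ->
  ~ sigma_acyclic R [set: X].
Proof.
move=> selE dE fF [h [ch hh]] [A hA AT].
have f0 k : 0 < f k by apply: leq_trans (fF k).
have bB n : baire_property (h @^-1` A n).
  by apply: borel_baire_property => //; apply: borel_preimage => //; have [] := hA n.
have nilT : in_tree f [::] by [].
have [[n [t [tT _ [D dD DA]]]]|[D dD DN]] := comeager_on_bigcup f0 nilT bB;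
  last first.
  have [x xf gx] := exists_generic f0 dD.
  pose y : branches f := SigSub (mem_set (xf : branches f x)).
  have := DN y erefl gx; apply.
  by have : [set: X] (h y) by []; rewrite AT => -[n _ ?]; exists n.
have [l] := dE f t fF tT; set e := E (restr f l) => te.
have eF : calF_fin (restr f l).
  by move=> k; rewrite size_mkseq => kl; rewrite nth_mkseq.
have [se eT] := selE _ eF; rewrite size_mkseq in se eT.
have eT' : in_tree f e.
  by move=> k; rewrite se => kl; have := eT k kl; rewrite nth_mkseq.
pose D' k := if unpickle k is Some (n', i) then
  [set u | i < f l -> exists2 r, D n' r & prefix r (rcons e i ++ u)] else setT.
pose f' k := f (l.+1 + k).
have [k|x xf gx] := @exists_generic f' D' (fun k => f0 _).
  rewrite /D'; case: unpickle => [[n' i]|]; last first.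
    by move=> r rT; exists r; rewrite prefix_refl.
  move=> u uT; have [il|il] := ltnP i (f l); last first.
    by exists u; rewrite prefix_refl; split=> // il'; move: il; rewrite leqNgt il'.
  have [|r [rT /prefixP[v rE] Dr]] := dD n' (rcons e i ++ u).
    apply/in_tree_cat; split; last by rewrite size_rcons se.
    rewrite -cats1; apply/in_tree_cat; split=> // -[|//] _ /=.
    by rewrite se addn0.
  exists (u ++ v); split.
  - by move: rT; rewrite rE -catA => /in_tree_cat[_]; rewrite size_rcons se.
  - exact: prefix_prefix.
  - by move=> _; exists r => //; rewrite catA -rE prefix_refl.
pose y i : nat -> nat := concat (rcons e i) x.
have yf i : i < f l -> branches f (y i).
  move=> il k; rewrite /y /concat size_rcons se nth_rcons se.
  case: (ltnP k l.+1) => [|lk].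
    rewrite ltnS leq_eqVlt => /orP[/eqP->|kl]; first by rewrite ltnn eqxx.
    by rewrite kl; apply: eT'; rewrite se.
  by have := xf (k - l.+1); rewrite /f' subnKC.
have yE i m : mkseq (y i) (l.+1 + m) = rcons e i ++ mkseq x m.
  rewrite /mkseq iotaD map_cat add0n; congr (_ ++ _).
    apply: (@eq_from_nth _ 0); rewrite size_map size_iota ?size_rcons ?se // => k kl.
    by rewrite (nth_map 0) ?size_iota // nth_iota // add0n /y /concat size_rcons se kl.
  rewrite -[l.+1]addn0 iotaDl -map_comp; apply: eq_map => k /=.
  by rewrite /y /concat size_rcons se ltnNge leq_addr /= addKn.
case fl : (f l) (f0 l) => [//|m] _.
have yf' (i : 'I_m.+1) : branches f (y i) by apply: yf; rewrite fl.
pose b (i : 'I_m.+1) : branches f := SigSub (mem_set (yf' i)).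
have bE i : (set_val (b i) : nat -> nat) = y i by rewrite /b set_valE.
have [_] := hA n; apply; exists m, (fun i => h (b i)); split=> i.
  apply: DA.
    apply: (@prefix_mkseq l.+1); rewrite bE -[l.+1]addn0 yE.
    by apply: prefix_trans te _; rewrite cats0; exact: prefix_rcons.
  move=> n'; have [M] := gx (pickle (n', i : nat)).
  rewrite /D' pickleK => -[|r Dr]; first by rewrite fl.
  by rewrite -yE => /prefix_mkseq rE; exists (size r); rewrite bE rE.
apply: hh; exists l, x; rewrite !bE /y.
have cl j : concat (rcons e j) x l = j.
  by rewrite /concat size_rcons se ltnSn nth_rcons se ltnn eqxx.
rewrite !cl; split=> //.
by rewrite fl addn1.
Qed.

(** * The dichotomy *)

Lemma weak_borel_colorable_le (X : topologicalType) (R : set (X * X))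
    (I : Type) (kappa : set I) (mu : set nat) :
  weak_borel_colorable R kappa -> kappa #<= mu -> weak_borel_colorable R mu.
Proof.
move=> [A [bA aA AT]] /pcard_leP[g].
have /choice[B hB] : forall n, exists B : set X, [/\ borel B, acyclic R B &
    forall i, kappa i -> g i = n -> B = A i].
  move=> n; have [[i [ki gi]]|nex] := pselect (exists i, kappa i /\ g i = n).
    exists (A i); split; [exact: bA|exact: aA|move=> j kj gj].
    by congr A; apply: (@inj _ _ _ g); rewrite ?inE //; exact: etrans gi (esym gj).
  exists set0; split; [exact: borel0|exact: acyclic0|move=> i ki gi].
  by case: nex; exists i.
exists B; split=> [n _|n _|].
- by have [] := hB n.
- by have [] := hB n.
- rewrite -subTset -AT => x [i ki Ax]; exists (g i); first exact: (@funS _ _ _ _ g).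
  by have [_ _ /(_ i ki erefl) ->] := hB (g i).
Qed.

(** A countable dichromatic number is attained, since among the countable cardinals
that suffice there is a least one: a finite one if some finite cardinal suffices,
and that of nat otherwise. *)
Lemma countable_dichromaticP (X : topologicalType) (R : set (X * X)) :
  countable_weak_borel_dichromatic_number R <-> sigma_acyclic R [set: X].
Proof.
split=> [[I [kappa [[kc _] kN]]]|[A hA AT]].
  have [A [bA aA AT]] := weak_borel_colorable_le kc kN.
  by exists A => [n|]; [split; [exact: bA|exact: aA]|rewrite AT].
have cN : weak_borel_colorable R [set: nat].
  exists A; split=> [n _|n _|]; last by rewrite AT.
    by have [] := hA n.
  by have [_] := hA n.
have fin_le (J : Type) (lambda : set J) : weak_borel_colorable R lambda ->
    infinite_set lambda \/ exists2 m, lambda #= `I_m & weak_borel_colorable R `I_m.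
  move=> lc; have [|] := pselect (finite_set lambda); last by left.
  move=> /finite_setP[m lm]; right; exists m => //.
  by apply: weak_borel_colorable_le lc _; move: lm; rewrite card_eq_le => /andP[].
have [[n0 hn0]|nfin] := pselect (exists n, weak_borel_colorable R `I_n).
  have exn : exists n, `[< weak_borel_colorable R `I_n >] by exists n0; apply/asboolP.
  case: (ex_minnP exn) => n /asboolP nc nmin.
  exists nat, `I_n; split; last exact: subset_card_le.
  split=> // J lambda /fin_le[/infiniteP|[m]].
    by apply: card_le_trans; exact: subset_card_le.
  rewrite card_eq_le => /andP[_ ml] mc; apply: card_le_trans ml.
  by rewrite card_le_II; apply: nmin; apply/asboolP.
exists nat, [set: nat]; split; last exact: card_lexx.
split=> // J lambda /fin_le[/infiniteP//|[m _ mc]].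
by case: nfin; exists m.
Qed.

Lemma analytic_souslin (K : realType) (X : topologicalType) (A : set X) :
  analytic K A -> souslin A.
Proof.
by move=> [Y [g [pY cg <-]]]; exact: souslin_image cg (souslin_polish pY).
Qed.

Lemma exists_hom_from_G0 (K : realType) (X : topologicalType) (R : set (X * X))
    (E : seq nat -> seq nat) :
  analytic_digraph K R -> ~ sigma_acyclic R [set: X] -> selector E ->
  exists f, [/\ calF f, selector_monotone E f, continuous_hom_from_G0 R E f &
    forall k, uniform_digraph k R -> forall n, f n <= k + 1].
Proof.
move=> [pX irrR /analytic_souslin[CR cCR CRE]] nR selE.
have [CX cCX CXE] := souslin_polish pX.
have {}CXE x : exists a, CX a x by apply/CXE.
have [S S0 hS] := exists_stages pX irrR selE cCX CXE cCR CRE nR.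
have gS n : good R CX CR (S n) by have [] := hS n.
have stS n : step R E CX CR (S n) (S n.+1) by have [] := hS n.
exists (limit_shape S); split.
- exact: calF_limit stS.
- exact: (limit_monotone selE S0 gS stS).
- exact: (limit_hom pX selE cCX cCR CRE S0 gS stS).
- by move=> k uk n; have [_ [_ h] _ _ _] := limit_step stS n; exact: h.
Qed.

Theorem theorem3p25 (K : realType) (X : topologicalType) (R : set (X * X))
    (hR : analytic_digraph K R) :
  let alt1 := countable_weak_borel_dichromatic_number R in
  let alt2 :=
    forall E : seq nat -> seq nat, selector E ->
      exists f : nat -> nat,
        [/\ calF f, selector_monotone E f & continuous_hom_from_G0 R E f] in
  ((alt1 \/ alt2) /\ ~ (alt1 /\ alt2)) /\
  (forall k : nat, uniform_digraph k R -> alt2 ->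
    forall E : seq nat -> seq nat, selector E ->
      exists f : nat -> nat,
        [/\ calF f, selector_monotone E f, continuous_hom_from_G0 R E f &
            forall n, f n <= k + 1]).
Proof.
move=> alt1 alt2.
have excl : ~ (alt1 /\ alt2).
  move=> [/countable_dichromaticP sR a2].
  have [E selE dE] := exists_dense_selector.
  have [f [fF _ fhom]] := a2 E selE.
  exact: no_hom_from_dense_G0 selE dE fF fhom sR.
split; first split=> //.
  have [a1|na1] := pselect alt1; [by left|right=> E selE].
  have [|f [fF fmon fhom _]] := exists_hom_from_G0 hR _ selE; last by exists f.
  by move=> /countable_dichromaticP.
move=> k uk a2 E selE.
have [|f [fF fmon fhom fb]] := exists_hom_from_G0 hR _ selE.
  by move=> /countable_dichromaticP a1; apply: excl.
by exists f; split=> // n; exact: fb.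
Qed.
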